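(* Let $C$ be an absolute constant such that for every weight $w$ on $\mathbb{R}$ satisfying the dyadic Muckenhoupt condition with respect to the standard dyadic lattice $\mathscr{D}$ of $\mathbb{R}$, and all real $f\in L^2(w)$, $g\in L^2(w^{-1})$, \[ \sum_{I\in\mathscr{D}} \left|\langle f\rangle_{I_1}-\langle f\rangle_{I_2}\right|\cdot\left|\langle g\rangle_{I_1}-\langle g\rangle_{I_2}\right|\cdot|I| \le C\,[w]_{A_2^{d}}\,\|f\|_{L^2(w)}\|g\|_{L^2(w^{-1})}, \] where $I_1,I_2$ are the two children of $I$ (such a constant exists by a theorem of Wittwer). Let $\mathscr{D}$ be a dyadic lattice in $\mathbb{R}^d$, let $n\ge 1$ and let $\text{Ш}$ be a Haar shift of complexity $n$ (with respect to $\mathscr{D}$), and let $w$ be a weight on $\mathbb{R}^d$ with $[w]_{A_2^{d}}<\infty$. Then $\text{Ш}$ is bounded on $L^2(w)$ and \[ \|\text{Ш}\|_{L^2(w)\to L^2(w)}\le 324\, n\, 2^{2d-2}\, C\, [w]_{A_2^{d}}. \]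
   Context: A dyadic lattice $\mathscr{D}$ in $\mathbb{R}^d$ is a system of the form $\{I\dot+\omega: I\in\mathscr{D}^0\}$, where $\mathscr{D}^0=\{2^k([0,1)^d+m): k\in\mathbb{Z}, m\in\mathbb{Z}^d\}$ and, for $I\in\mathscr{D}^0$ of side $2^k$ and $\omega\in(\{0,1\}^d)^{\mathbb{Z}}$, $I\dot+\omega=I+\sum_{j<k}\omega_j2^j$. For a cube $I$, $\operatorname{chld}(I)$ is the set of its $2^d$ dyadic children, $\operatorname{chld}_0(I)=\{I\}$ and $\operatorname{chld}_k(I)$ the set of its dyadic descendants of order $k$. $\langle f\rangle_I=|I|^{-1}\int_I f$, $\mathbb{E}_I f=\langle f\rangle_I\mathbf 1_I$, $\Delta_I=-\mathbb{E}_I+\sum_{J\in\operatorname{chld}(I)}\mathbb{E}_J$, and $\Delta_Q^n=\sum_{k=0}^{n-1}\sum_{R\in\operatorname{chld}_k(Q)}\Delta_R=-\mathbb{E}_Q+\sum_{J\in\operatorname{chld}_n(Q)}\mathbb{E}_J$. A Haar shift of complexity $n$ is an operator $\text{Ш} f=\sum_{Q\in\mathscr{D}}\text{Ш}_Q\Delta_Q^n f$ (one may assume finitely many nonzero terms; estimates are uniform in their number), where each $\text{Ш}_Q$ maps $\Delta_Q^nL^2$ into $\Delta^n_QL^2$ and is given by a kernel $a_Q$ supported in $Q\times Q$ with $\|a_Q\|_\infty\le|Q|^{-1}$, i.e. $\langle \text{Ш}_Qf,g\rangle=\int\int a_Q(x,y)f(y)g(x)\,dx\,dy$ for $f,g\in\Delta_Q^nL^2$.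 The weighted space $L^2(w)$ has norm $\|f\|_{L^2(w)}^2=\int|f|^2w$. The dyadic Muckenhoupt norm is $[w]_{A_2^{d}}=\sup_{I\in\mathscr{D}}\langle w\rangle_I\langle w^{-1}\rangle_I$. *)

(* Defs.v *)
From HB Require Import structures.
From mathcomp Require Import all_boot all_order all_algebra.
From mathcomp Require Import all_classical all_reals all_analysis.
Set Implicit Arguments. Unset Strict Implicit. Unset Printing Implicit Defensive.
Import Order.TTheory GRing.Theory Num.Theory.
Local Open Scope classical_set_scope.
Local Open Scope ring_scope.

Notation pt R dim := (dim.-tuple (measurableTypeR R)).

(* Lebesgue integration on R^dim.  The integral of a nonnegative (measurable)  *)
(* function w.r.t. the dim-dimensional Lebesgue measure is the iterated       *)
(* integral of one-dimensional Lebesgue integrals (Tonelli); the integral of   *)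
(* a signed function is the integral of its positive part minus that of its   *)
(* negative part.                                                             *)
Fixpoint intR (R : realType) (dim : nat) : (pt R dim -> \bar R) -> \bar R :=
  match dim return (pt R dim -> \bar R) -> \bar R with
  | 0 => fun F => F [tuple]
  | dim'.+1 => fun F =>
      (\int[@lebesgue_measure R]_x intR (fun t => F (cons_tuple x t)))%E
  end.

Definition intS (R : realType) (dim : nat) (f : pt R dim -> R) : \bar R :=
  (intR (fun x => (Num.max (f x) 0)%:E) - intR (fun x => (Num.max (- f x) 0)%:E))%E.

Definition null_set (R : realType) (dim : nat) (N : set (pt R dim)) : Prop :=
  measurable N /\ intR (fun x => (\1_N x : R)%:E) = 0%E.

Definition ae_eq (R : realType) (dim : nat) (f g : pt R dim -> R) : Prop :=
  exists N, null_set N /\ forall x, ~ N x -> f x = g x.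

(* Dyadic lattices.  omega : int -> 'I_dim -> bool is the element of          *)
(* ({0,1}^dim)^Z.  A cube of D^0 is indexed by (k, m) : its side is 2^k and   *)
(* it equals 2^k([0,1)^dim + m).                                              *)
Definition cidx (dim : nat) := (int * {ffun 'I_dim -> int})%type.

Definition side (R : realType) (k : int) : R := (2 : R) ^ k.

(* i-th coordinate of sum_{j<k} omega_j 2^j = sum_{l>=1} omega_{k-l} 2^{k-l} *)
Definition dshift (R : realType) (dim : nat) (omega : int -> 'I_dim -> bool)
    (k : int) (i : 'I_dim) : R :=
  limn (fun N : nat => \sum_(1 <= l < N) ((omega (k - l%:Z) i)%:R * side R (k - l%:Z))).

Definition cube (R : realType) (dim : nat) (omega : int -> 'I_dim -> bool)
    (Q : cidx dim) : set (pt R dim) :=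
  [set x | forall i : 'I_dim,
      side R Q.1 * (Q.2 i)%:~R + dshift R omega Q.1 i <= tnth x i /\
      tnth x i < side R Q.1 * (Q.2 i + 1)%:~R + dshift R omega Q.1 i].

Arguments side R k.
Arguments dshift R {dim} omega k i.
Arguments cube R {dim} omega Q.

Definition vol (R : realType) (dim : nat) (Q : cidx dim) : R := side R Q.1 ^+ dim.

Arguments vol R {dim} Q.

Definition descendants (R : realType) (dim : nat) (omega : int -> 'I_dim -> bool)
    (n : nat) (Q : cidx dim) : set (cidx dim) :=
  [set J | J.1 = Q.1 - n%:Z /\ cube R omega J `<=` cube R omega Q].

Definition avg (R : realType) (dim : nat) (omega : int -> 'I_dim -> bool)
    (f : pt R dim -> R) (Q : cidx dim) : R :=
  (vol R Q)^-1 * fine (intS (fun x => f x * \1_(cube R omega Q) x)).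

Definition Eavg (R : realType) (dim : nat) (omega : int -> 'I_dim -> bool)
    (Q : cidx dim) (f : pt R dim -> R) : pt R dim -> R :=
  fun x => avg omega f Q * \1_(cube R omega Q) x.

Definition DeltaN (R : realType) (dim : nat) (omega : int -> 'I_dim -> bool)
    (n : nat) (Q : cidx dim) (f : pt R dim -> R) : pt R dim -> R :=
  fun x => - Eavg omega Q f x
           + \sum_(J \in descendants R omega n Q) Eavg omega J f x.

Definition weight (R : realType) (dim : nat) (w : pt R dim -> R) : Prop :=
  measurable_fun setT w /\ forall x, 0 < w x.

Definition winv (R : realType) (dim : nat) (w : pt R dim -> R) : pt R dim -> R :=
  fun x => (w x)^-1.

Definition L2int (R : realType) (dim : nat) (w f : pt R dim -> R) : \bar R :=
  intR (fun x => (f x ^+ 2 * w x)%:E).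

Definition inL2w (R : realType) (dim : nat) (w f : pt R dim -> R) : Prop :=
  measurable_fun setT f /\ (L2int w f < +oo)%E.

Definition inL2 (R : realType) (dim : nat) (f : pt R dim -> R) : Prop :=
  inL2w (fun _ => 1) f.

Definition L2norm (R : realType) (dim : nat) (w f : pt R dim -> R) : R :=
  Num.sqrt (fine (L2int w f)).

Definition wavg (R : realType) (dim : nat) (omega : int -> 'I_dim -> bool)
    (w : pt R dim -> R) (Q : cidx dim) : \bar R :=
  ((vol R Q)^-1%:E * intR (fun x => (w x * \1_(cube R omega Q) x)%:E))%E.

Definition A2 (R : realType) (dim : nat) (omega : int -> 'I_dim -> bool)
    (w : pt R dim -> R) : \bar R :=
  ereal_sup (range (fun Q : cidx dim => (wavg omega w Q * wavg omega (winv w) Q)%E)).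

Definition inDeltaL2 (R : realType) (dim : nat) (omega : int -> 'I_dim -> bool)
    (n : nat) (Q : cidx dim) (f : pt R dim -> R) : Prop :=
  exists h, inL2 h /\ f = DeltaN omega n Q h.

(* A Haar shift of complexity n : a finite (duplicate-free) list s of cubes   *)
(* carrying the possibly nonzero terms, and the operators Sh Q, each mapping  *)
(* Delta_Q^n L^2 into itself and given by a kernel a_Q supported in Q x Q     *)
(* with |a_Q| <= |Q|^{-1}.                                                    *)
Definition haar_shift (R : realType) (dim : nat) (omega : int -> 'I_dim -> bool)
    (n : nat) (s : seq (cidx dim))
    (Sh : cidx dim -> (pt R dim -> R) -> (pt R dim -> R)) : Prop :=
  uniq s /\
  forall Q, Q \in s ->
    exists a : pt R dim -> pt R dim -> R,
      measurable_fun setT (fun xy : pt R dim * pt R dim => a xy.1 xy.2) /\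
      (forall x y, ~ (cube R omega Q x /\ cube R omega Q y) -> a x y = 0) /\
      (forall x y, `|a x y| <= (vol R Q)^-1) /\
      (forall f, inDeltaL2 omega n Q f ->
         measurable_fun setT (Sh Q f) /\
         exists g, inDeltaL2 omega n Q g /\ ae_eq (Sh Q f) g) /\
      (forall f g, inDeltaL2 omega n Q f -> inDeltaL2 omega n Q g ->
         intS (fun x => Sh Q f x * g x) =
         intS (fun x => fine (intS (fun y => a x y * f y)) * g x)).

Definition haar_apply (R : realType) (dim : nat) (omega : int -> 'I_dim -> bool)
    (n : nat) (s : seq (cidx dim))
    (Sh : cidx dim -> (pt R dim -> R) -> (pt R dim -> R))
    (f : pt R dim -> R) : pt R dim -> R :=
  fun x => \sum_(Q <- s) Sh Q (DeltaN omega n Q f) x.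

Definition omega0 : int -> 'I_1 -> bool := fun _ _ => false.

Definition child1 (I : cidx 1) : cidx 1 := (I.1 - 1, [ffun i => 2 * I.2 i]).
Definition child2 (I : cidx 1) : cidx 1 := (I.1 - 1, [ffun i => 2 * I.2 i + 1]).

Definition wittwer_const (R : realType) (C : R) : Prop :=
  forall w : pt R 1 -> R, weight w -> (A2 omega0 w < +oo)%E ->
  forall f g : pt R 1 -> R, inL2w w f -> inL2w (winv w) g ->
    (\esum_(I in [set: cidx 1])
        (`|avg omega0 f (child1 I) - avg omega0 f (child2 I)| *
         `|avg omega0 g (child1 I) - avg omega0 g (child2 I)| * vol R I)%:E
     <= C%:E * A2 omega0 w * (L2norm w f)%:E * (L2norm (winv w) g)%:E)%E.

(* Main.v *)
Require Import Defs.
From HB Require Import structures.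
From mathcomp Require Import all_boot all_order all_algebra.
From mathcomp Require Import all_classical all_reals all_analysis.
From mathcomp Require Import measurable_realfun.
From mathcomp Require Import ring lra zify.
Import Order.TTheory GRing.Theory Num.Theory.
Import numFieldNormedType.Exports.
Local Open Scope classical_set_scope.
Local Open Scope ring_scope.
Set Implicit Arguments. Unset Strict Implicit. Unset Printing Implicit Defensive.

(* Grouping cubes by the residue of their scale mod [n] and using
   [|a_Q| <= 1/|Q|], the form [<Sh f, g>] is at most
   [sum_Q |Q| osc_Q(f) osc_Q(g)], where [osc_Q(f)] is the mean of
   [|<f>_J - <f>_Q|] over the order-[n] descendants [J] of [Q].
   Wittwer's inequality on the line, tested on step functions attached to finite
   binary trees, yields a Bellman function [B(u, v, f, g)] on
   [1 <= u v <= K] with [-(CK/2)(f^2/v + g^2/u) <= B <= 0], a midpoint inequality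
   with gain [|f1 - f2| |g1 - g2|], and hence concavity along segments of the
   domain.  If [al] is a sign pattern on the descendants of [Q] correlated with
   both oscillations, the reweighted averages with densities
   [1 +- (al - <al>)/8] are two points of the domain with midpoint the averages
   over [Q]; the midpoint inequality there, followed by concavity down the dyadic
   tree of [Q], gains [osc_Q(f) osc_Q(g)/80] in one step whatever [n] is.  Splitting
   a cube one coordinate at a time multiplies the [A_2] norm by at most [2^(2d-2)],
   and the reweighting by at most [4], whence [K = 4 2^(2d-2) [w]] and the constant
   [320 n 2^(2d-2) C [w]]. *)

(** * Lebesgue measure on tuples *)

(** The obstacle is that the domain [1 <= u v <= K] is not convex: a segment joining two of its
    points may leave it, so Jensen's inequality cannot be applied to all descendants of a cube at
    once and concavity must be followed node by node. Room is made by enlarging the upper bound.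
    Densities confined to [[3/4, 5/4]] raise a normalised average by a factor at most [5/3], and a
    segment whose endpoints and midpoint satisfy [u v <= A] stays below [9/8 A]; since
    [(5/3)^2 * 9/8 = 25/8 < 4], every segment met on the way lies in the domain with [K = 4 A]. A
    theorem on the line serves in every dimension because the Bellman function sees only a binary
    tree of averages, never the geometry of the cubes. The depth of that tree costs nothing, so the
    complexity enters only linearly, through the number of scales occupied by the topmost cubes. The
    norm bound is recovered from an estimate by the sum of two energies: rescaling [f] and [g]
    against each other turns the constant 160 of that estimate into 320. *)

Section cons_measure.
Context {R : realType} (dim : nat) (mu : {sigma_finite_measure set (pt R dim) -> \bar R}).

Definition tcons (z : measurableTypeR R * pt R dim) : pt R dim.+1 :=
  cons_tuple z.1 z.2.

Lemma measurable_tcons : measurable_fun setT tcons.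
Proof.
apply/measurable_fun_tnthP => i.
case: (unliftP ord0 i) => [j ->|->].
  apply: (eq_measurable_fun (fun z => tnth z.2 j)) => [z _ /=|].
    by rewrite tnthS.
  exact: (measurableT_comp (measurable_tnth j) measurable_snd).
apply: (eq_measurable_fun (fun z => z.1)) => [z _ /=|].
  by rewrite tnth0.
exact: measurable_fst.
Qed.

(** The product of Lebesgue measure on the line with [mu], transported to tuples. It is built one
    coordinate at a time so that its integral unfolds exactly as [intR] does. *)
Definition cons_measure : set (pt R dim.+1) -> \bar R :=
  pushforward (@lebesgue_measure R \x mu)%E tcons.

Let cm0 : cons_measure set0 = 0%E.
Proof. by rewrite /cons_measure /pushforward preimage_set0 measure0. Qed.

Let cm_ge0 A : (0 <= cons_measure A)%E.
Proof. by rewrite /cons_measure /pushforward; exact: measure_ge0. Qed.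

Let cm_sigma_additive : semi_sigma_additive cons_measure.
Proof.
move=> F mF tF mUF; rewrite /cons_measure /pushforward preimage_bigcup.
apply: measure_semi_sigma_additive.
- by move=> n; rewrite -[X in measurable X]setTI; exact: measurable_tcons.
- apply/trivIsetP => /= i j _ _ ij; rewrite -preimage_setI.
  by move/trivIsetP : tF => /(_ _ _ _ _ ij) ->//; rewrite preimage_set0.
- by rewrite -preimage_bigcup -[X in measurable X]setTI; exact: measurable_tcons.
Qed.

HB.instance Definition _ := isMeasure.Build _ _ _ cons_measure
  cm0 cm_ge0 cm_sigma_additive.

Definition tuncons (t : pt R dim.+1) : measurableTypeR R * pt R dim :=
  (thead t, [tuple of behead t]).

Lemma measurable_tuncons : measurable_fun setT tuncons.
Proof.
apply/measurable_fun_pairP; split => /=.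
  exact: (@measurable_tnth _ _ _ ord0).
exact: measurable_behead.
Qed.

Let cm_sigma_finite : sigma_finite setT cons_measure.
Proof.
have /sigma_finiteP[F [TF ndF Foo]] := sigma_finiteT (@lebesgue_measure R).
have /sigma_finiteP[G [TG ndG Goo]] := sigma_finiteT mu.
(* Both exhaustions increase, so a point of [F n] times [G m] lies in the product of index
   [maxn n m]: the diagonal family covers. *)
exists (fun n => tuncons @^-1` (F n `*` G n)).
  rewrite -preimage_bigcup (_ : \bigcup_n _ = setT) ?preimage_setT //.
  apply/seteqP; split=> // -[x t] _ /=.
  have [n _ Fn] : (\bigcup_n F n) x by rewrite -TF.
  have [m _ Gm] : (\bigcup_n G n) t by rewrite -TG.
  exists (maxn n m) => //; split => /=.
    by move: x Fn; exact/subsetPset/ndF/leq_maxl.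
  by move: t Gm; exact/subsetPset/ndG/leq_maxr.
move=> n; have [mFn Fn] := Foo n; have [mGn Gn] := Goo n; split.
  by rewrite -[X in measurable X]setTI; apply: measurable_tuncons => //; exact: measurableX.
rewrite /cons_measure /pushforward -comp_preimage.
rewrite (_ : tuncons \o tcons = id) ?preimage_id.
  by rewrite product_measure1E// lte_mul_pinfty// ge0_fin_numE.
apply/funext => -[x t]; rewrite /tuncons /tcons /= theadE; congr pair.
exact: val_inj.
Qed.

HB.instance Definition _ := @Measure_isSigmaFinite.Build _ _ _ cons_measure
  cm_sigma_finite.

Lemma integral_cons_measure (F : pt R dim.+1 -> \bar R) :
  measurable_fun setT F ->
  (forall x, 0 <= F x)%E ->
  (\int[cons_measure]_x F x =
   \int[@lebesgue_measure R]_x \int[mu]_t F (cons_tuple x t))%E.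
Proof.
move=> mF F0; rewrite ge0_integral_pushforward//=.
  rewrite preimage_setT fubini_tonelli1//.
  exact: (measurableT_comp mF measurable_tcons).
exact: measurable_tcons.
Qed.

End cons_measure.

Section lebn.
Context {R : realType}.

Lemma measurable_cons_tuple dim (x : measurableTypeR R) :
  measurable_fun setT (fun t : pt R dim => (cons_tuple x t : pt R dim.+1)).
Proof.
exact: (measurableT_comp (@measurable_tcons R dim) (pair1_measurable x)).
Qed.

Fixpoint lebn (dim : nat) : {sigma_finite_measure set (pt R dim) -> \bar R} :=
  match dim with
  | 0 => @dirac _ (pt R 0) [tuple] R
  | dim'.+1 => cons_measure (lebn dim')
  end.

(** Tonelli, one coordinate at a time. It turns the iterated integral of the definitions into an
    integral against a measure, where the usual comparison theorems apply. *)
Lemma intRE dim (F : pt R dim -> \bar R) : measurable_fun setT F ->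
  (forall x, 0 <= F x)%E -> intR F = (\int[lebn dim]_x F x)%E.
Proof.
elim: dim F => [|dim IH] F mF F0 /=.
  by rewrite integral_dirac // diracT mul1e.
rewrite integral_cons_measure //; apply: eq_integral => x _.
apply: IH => //.
exact: (measurableT_comp mF (@measurable_cons_tuple dim x)).
Qed.

End lebn.

Section boxes.
Context {R : realType}.

Lemma intSE dim (f : pt R dim -> R) : measurable_fun setT f ->
  Defs.intS f = (\int[lebn dim]_x (f x)%:E)%E.
Proof.
move=> mf; rewrite integralE /Defs.intS !intRE //.
- congr (_ - _)%E; apply: eq_integral => x _.
    by rewrite funeposE EFin_max.
  by rewrite funenegE -EFinN EFin_max.
- apply/measurable_EFinP; apply: measurable_maxr => //.
  exact: measurableT_comp.
- by move=> x; rewrite lee_fin le_max lexx orbT.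
- by apply/measurable_EFinP; apply: measurable_maxr.
- by move=> x; rewrite lee_fin le_max lexx orbT.
Qed.

Definition box dim (a b : 'I_dim -> R) : set (pt R dim) :=
  [set x | forall i, a i <= tnth x i < b i].

Lemma measurable_box dim (a b : 'I_dim -> R) : measurable (box a b).
Proof.
have -> : box a b = \bigcap_(i in [set: 'I_dim]) ((fun x => tnth x i) @^-1` `[a i, b i[).
  apply/seteqP; split => x /= H i; first by move=> _ /=; rewrite in_itv/=.
  by have := H i I; rewrite /= in_itv.
apply: fin_bigcap_measurable => // i _.
by rewrite -[X in measurable X]setTI; apply: measurable_tnth.
Qed.

Lemma lebn_box dim (a b : 'I_dim -> R) : (forall i, a i <= b i) ->
  lebn dim (box a b) = (\prod_(i < dim) (b i - a i))%:E.
Proof.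
elim: dim a b => [|dim IH] a b ab.
  rewrite big_ord0 /= diracE mem_set// => -[]//.
rewrite big_ord_recl /= /cons_measure /pushforward.
have -> : @tcons R dim @^-1` box a b =
   `[a ord0, b ord0[ `*` box (a \o lift ord0) (b \o lift ord0).
  apply/seteqP; split => -[x t] /=.
    move=> H; split.
      by have := H ord0; rewrite tnth0 in_itv.
    by move=> i; have := H (lift ord0 i); rewrite tnthS.
  move=> [] /=; rewrite in_itv => H0 H1 i.
  by case: (unliftP ord0 i) => [j ->|->]; rewrite ?tnth0 // tnthS; exact: H1.
rewrite product_measure1E; [|exact: measurable_itv|exact: measurable_box].
rewrite IH => [|i]; last exact: ab.
rewrite EFinM; congr (_ * _)%E.
transitivity (@lebesgue_measure R `[a ord0, b ord0[); first by [].
rewrite lebesgue_measure_itv /= lte_fin.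
have := ab ord0; rewrite le_eqVlt => /predU1P[->|->]; last by [].
by rewrite ltxx subrr.
Qed.

End boxes.

(** * Dyadic lattices *)

Section dyadic.
Context {R : realType} {dim : nat} (omega : int -> 'I_dim -> bool).
Implicit Types (Q J : cidx dim) (x : pt R dim).

Lemma side_gt0 k : 0 < side R k.
Proof. by rewrite /side exprz_gt0. Qed.

Lemma sideS k : side R (k + 1) = 2 * side R k.
Proof. by rewrite /side expfzDr // expr1z mulrC. Qed.

Lemma vol_gt0 Q : 0 < vol R Q.
Proof. by rewrite /vol exprn_gt0 // side_gt0. Qed.

Let partial_shift k (i : 'I_dim) (N : nat) : R :=
  \sum_(1 <= l < N) ((omega (k - l%:Z) i)%:R * side R (k - l%:Z)).

(** [dshift] is a [limn], meaningless without convergence. The partial sums increase, and the first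
    [N] terms add up to at most [2^k - 2^(k-N)]. *)
Lemma is_cvg_partial_shift k i : cvgn (partial_shift k i).
Proof.
have term_ge0 l : 0 <= (omega (k - l%:Z) i)%:R * side R (k - l%:Z).
  by rewrite mulr_ge0 // ?ler0n // ltW // side_gt0.
apply: nondecreasing_is_cvgn.
  apply/nondecreasing_seqP => N; rewrite /partial_shift.
  case: N => [|N]; first by rewrite big_geq // big_geq.
  by rewrite [leRHS]big_nat_recr //= lerDl.
exists (side R k) => _ [N _ <-].
suff H : partial_shift k i N.+1 <= side R k - side R (k - N%:Z).
  rewrite (le_trans _ (le_trans H _)) //; last by rewrite gerBl ltW // side_gt0.
  case: N {H} => [|N]; rewrite /partial_shift; first by rewrite big_geq // big_geq.
  by rewrite [leRHS]big_nat_recr //= lerDl.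
elim: N => [|N IH]; first by rewrite /partial_shift big_geq // subr0 subrr.
rewrite /partial_shift big_nat_recr //= -/(partial_shift k i N.+1).
have := side_gt0 (k - N.+1%:Z).
move: IH; have -> : k - N%:Z = (k - N.+1%:Z) + 1 by lia.
rewrite sideS; case: (omega _ i) => /=; rewrite ?mul1r ?mul0r; lra.
Qed.

(** The compatibility of consecutive generations rests on this recursion: going up one scale adds a
    single binary digit to the shift. *)
Lemma dshiftS k i : dshift R omega (k + 1) i =
  dshift R omega k i + (omega k i)%:R * side R k.
Proof.
rewrite /dshift; apply/cvg_lim => //.
(* Offset 2 against 1: the sum at scale [k + 1] has one more leading term, [l = 1], equal to
   [omega_k 2^k]. *)
rewrite -(cvg_shiftn 2%N) /=.
have -> : (fun n => \sum_(1 <= l < n + 2)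
     ((omega (k + 1 - l%:Z) i)%:R * side R (k + 1 - l%:Z))) =
   (fun n => partial_shift k i (n + 1)%N + (omega k i)%:R * side R k).
  apply/funext => N; rewrite addn2 big_ltn // addrK addrC; congr (_ + _).
  rewrite /partial_shift addn1 big_add1 /=; apply: eq_bigr => l _.
  by have -> : k + 1 - l.+1%:Z = k - l%:Z by lia.
apply: cvgD; last exact: cvg_cst.
by rewrite (cvg_shiftn 1%N); exact: is_cvg_partial_shift.
Qed.

Definition corner Q (i : 'I_dim) : R :=
  side R Q.1 * (Q.2 i)%:~R + dshift R omega Q.1 i.

Lemma cubeE Q : cube R omega Q = box (corner Q) (fun i => corner Q i + side R Q.1).
Proof.
apply/seteqP; split => x /= H i; have := H i.
  by move=> [-> H2]; rewrite (lt_le_trans H2) // /corner intrD mulrDr mulr1 addrAC.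
by move=> /andP[-> H2]; split => //; rewrite (lt_le_trans H2) // /corner intrD mulrDr mulr1 addrAC.
Qed.

Lemma measurable_cube Q : measurable (cube R omega Q).
Proof. by rewrite cubeE; exact: measurable_box. Qed.

Lemma lebn_cube Q : lebn dim (cube R omega Q) = (vol R Q)%:E.
Proof.
rewrite cubeE lebn_box => [|i]; last by rewrite lerDl ltW // side_gt0.
rewrite (eq_bigr (fun=> side R Q.1)) => [|i _]; last by rewrite addrAC subrr add0r.
by rewrite prodr_const card_ord.
Qed.

(** Cubes of one scale partition space, so a point has exactly one index per scale; inclusion and
    disjointness of cubes become equations between indices. *)
Definition locate (k : int) (x : pt R dim) : cidx dim :=
  (k, [ffun i => Num.floor ((tnth x i - dshift R omega k i) / side R k)]).

Lemma cubeP Q x : cube R omega Q x <-> locate Q.1 x = Q.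
Proof.
have s0 := side_gt0 Q.1; split.
  move=> H; rewrite /locate [RHS]surjective_pairing; congr pair.
  apply/ffunP => i; rewrite ffunE; apply: floor_def.
  have [H1 H2] := H i.
  by rewrite ler_pdivlMr // ltr_pdivrMr // ![_ * side R _]mulrC lerBrDr ltrBlDr H1.
move=> + i; rewrite [RHS]surjective_pairing => -[/ffunP /(_ i)]; rewrite ffunE => <-.
have /andP := floor_itv ((tnth x i - dshift R omega Q.1 i) / side R Q.1).
rewrite ler_pdivlMr // ltr_pdivrMr // ![_ * side R _]mulrC.
by rewrite lerBrDr ltrBlDr.
Qed.

Lemma cube_neq0 Q : exists x, cube R omega Q x.
Proof.
exists [tuple corner Q i | i < dim]; rewrite cubeE => i.
by rewrite tnth_mktuple lexx ltrDl side_gt0.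
Qed.

(** By [dshiftS], the corner with index [m] at scale [k] sits at [(m - omega_k) / 2] in units of the
    next scale; rounding down gives the enclosing cube. *)
Definition parent Q : cidx dim :=
  (Q.1 + 1, [ffun i => ((Q.2 i - (omega Q.1 i)%:Z) %/ 2)%Z]).

Definition child Q (e : {ffun 'I_dim -> bool}) : cidx dim :=
  (Q.1 - 1, [ffun i => 2 * Q.2 i + (omega (Q.1 - 1) i)%:Z + (e i)%:Z]).

Lemma childK Q e : parent (child Q e) = Q.
Proof.
rewrite /parent /= subrK [RHS]surjective_pairing; congr pair.
by apply/ffunP => i; rewrite !ffunE; case: (omega _ i); case: (e i) => /=; lia.
Qed.

Lemma parentK Q : exists e, child (parent Q) e = Q.
Proof.
exists [ffun i => ((Q.2 i - (omega Q.1 i)%:Z) %% 2)%Z == 1].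
rewrite /child /= addrK [RHS]surjective_pairing; congr pair.
apply/ffunP => i; rewrite !ffunE; case: eqP; case: (omega _ _) => /=; lia.
Qed.

Lemma child_inj Q : injective (child Q).
Proof.
move=> e e' [/ffunP H]; apply/ffunP => i; have := H i; rewrite !ffunE.
by case: (e i) (e' i) => -[] //=; lia.
Qed.

(** In units of the cubes the coordinate [t] becomes [(t - omega_k) / 2] one scale up, and taking
    the floor of [t] before halving does not change the floor of the result. *)
Lemma parent_locate k x : parent (locate k x) = locate (k + 1) x.
Proof.
rewrite /parent /locate /=; congr pair; apply/ffunP => i; rewrite !ffunE.
apply/esym/floor_def; have s0 := side_gt0 k.
set t := (tnth x i - dshift R omega k i) / side R k.
have -> : (tnth x i - dshift R omega (k + 1) i) / side R (k + 1) =
          (t - (omega k i)%:R) / 2.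
  by rewrite dshiftS sideS /t; field; rewrite gt_eqF.
have /andP[] := floor_itv t; move: (Num.floor t) => m.
set q := ((m - (omega k i)%:Z) %/ 2)%Z; rewrite intrD => h1 h2.
have hq1 : 2 * q + (omega k i)%:Z <= m by rewrite /q; case: (omega k i) => /=; lia.
have hq2 : m + 1 <= 2 * q + 2 + (omega k i)%:Z by rewrite /q; case: (omega k i) => /=; lia.
move: hq1 hq2; rewrite -!(ler_int R) !(intrD,intrM) -!pmulrn => hq1 hq2.
rewrite ler_pdivlMr // ltr_pdivrMr //; apply/andP; split; lra.
Qed.

Lemma iter_parent1 n Q : (iter n parent Q).1 = Q.1 + n%:Z.
Proof. by elim: n => [|n IH]; rewrite ?addr0 //= IH; lia. Qed.

Lemma iter_parent_locate n k x : iter n parent (locate k x) = locate (k + n%:Z) x.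
Proof.
elim: n => [|n IH]; first by rewrite addr0.
rewrite /= IH parent_locate; congr locate; lia.
Qed.

(** A cube is nonempty and any one of its points determines all its ancestors through [locate], so
    geometric inclusion is iterated [parent]. *)
Lemma descendantsP n Q J : descendants R omega n Q J <-> iter n parent J = Q.
Proof.
split.
  move=> [J1 JQ]; have [x Jx] := cube_neq0 J.
  have /cubeP <- := JQ _ Jx; have /cubeP <- := Jx.
  by rewrite iter_parent_locate J1 subrK.
move=> JQ; split; first by rewrite -JQ iter_parent1 addrK.
move=> x /cubeP Jx; apply/cubeP.
rewrite -JQ iter_parent1 -{2}Jx iter_parent_locate //.
Qed.

Local Notation ind Q := (\1_(cube R omega Q) : pt R dim -> R).

Lemma ind_locate Q x : ind Q x = (locate Q.1 x == Q)%:R.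
Proof.
rewrite indicE; congr (nat_of_bool _)%:R.
by apply/idP/eqP => [/set_mem/cubeP|/cubeP/mem_set].
Qed.

Lemma ind_iter_parent n J x : ind (iter n parent J) x * ind J x = ind J x.
Proof.
rewrite !ind_locate; case: (eqVneq (locate J.1 x) J) => [E|]; last by rewrite mulr0.
by rewrite mulr1 iter_parent1 -{2}E iter_parent_locate eqxx.
Qed.

Lemma ind_disjoint n Q J x : Q.1 = J.1 + n%:Z -> iter n parent J != Q -> ind Q x * ind J x = 0.
Proof.
move=> QJ; rewrite !ind_locate.
case: (eqVneq (locate J.1 x) J) => [E|]; last by rewrite mulr0.
by rewrite -{1}E iter_parent_locate -QJ => /negbTE ->; rewrite mul0r.
Qed.

End dyadic.

(** * Binary trees of cubes *)

Section btree.
Context {R : realType} {X : Type}.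

(** Used for two kinds of leaves: cubes, when a cube is halved repeatedly, and value triples
    [(w, f, g)], when step functions are fed to Wittwer's inequality. Binary branching is what a
    midpoint inequality can follow. *)
Inductive btree := BLeaf of X | BNode of btree & btree.

Fixpoint bleaves (t : btree) : seq X :=
  match t with
  | BLeaf x => [:: x]
  | BNode l r => bleaves l ++ bleaves r
  end.

Fixpoint bmean (phi : X -> R) (t : btree) : R :=
  match t with
  | BLeaf x => phi x
  | BNode l r => (bmean phi l + bmean phi r) / 2
  end.

Fixpoint bbind (k : X -> btree) (t : btree) : btree :=
  match t with
  | BLeaf x => k x
  | BNode l r => BNode (bbind k l) (bbind k r)
  end.

Fixpoint bperfect (h : nat) (t : btree) : bool :=
  match h, t with
  | 0, BLeaf _ => true
  | h'.+1, BNode l r => bperfect h' l && bperfect h' r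
  | _, _ => false
  end.

Fixpoint bnodes (P : btree -> Prop) (t : btree) : Prop :=
  P t /\ if t is BNode l r then bnodes P l /\ bnodes P r else True.

Lemma bleaves_bind k t : bleaves (bbind k t) = flatten (map (bleaves \o k) (bleaves t)).
Proof.
by elim: t => [x|l IHl r IHr] /=; rewrite ?cats0 // IHl IHr map_cat flatten_cat.
Qed.

Lemma bmean_bind phi k t : bmean phi (bbind k t) = bmean (fun x => bmean phi (k x)) t.
Proof. by elim: t => //= l -> r ->. Qed.

Lemma bperfect_bind h h' k t : bperfect h t -> (forall x, bperfect h' (k x)) ->
  bperfect (h + h') (bbind k t).
Proof.
move=> + kP; elim: h t => [|h IH] [x|l r] //= /andP[Hl Hr].
by rewrite !IH.
Qed.

Lemma bmean_perfect h phi t : bperfect h t ->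
  bmean phi t = (2 ^+ h)^-1 * \sum_(x <- bleaves t) phi x.
Proof.
elim: h t => [|h IH] [x|l r] //=; first by rewrite expr0 invr1 mul1r big_seq1.
move=> /andP[Hl Hr]; rewrite !IH // big_cat /= exprS invfM.
by move: (2 ^+ h)^-1 => u; ring.
Qed.

Lemma bmeanD phi psi t : bmean (fun x => phi x + psi x) t = bmean phi t + bmean psi t.
Proof. by elim: t => //= l -> r ->; lra. Qed.

Lemma bmeanZ c phi t : bmean (fun x => c * phi x) t = c * bmean phi t.
Proof. by elim: t => //= l -> r ->; lra. Qed.

Lemma bmean_cst c t : bmean (fun=> c) t = c.
Proof. by elim: t => //= l -> r ->; lra. Qed.

Lemma le_bmean phi psi t : (forall x, phi x <= psi x) -> bmean phi t <= bmean psi t.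
Proof. by move=> H; elim: t => //= l IHl r IHr; lra. Qed.

Lemma bmean_gt0 phi t : (forall x, 0 < phi x) -> 0 < bmean phi t.
Proof. by move=> H; elim: t => //= l IHl r IHr; lra. Qed.

Lemma bmean_ge0 phi t : (forall x, 0 <= phi x) -> 0 <= bmean phi t.
Proof. by move=> H; elim: t => //= l IHl r IHr; lra. Qed.

Lemma eq_bmean phi psi t : phi =1 psi -> bmean phi t = bmean psi t.
Proof. by move=> H; elim: t => //= l -> r ->. Qed.

Lemma ler_norm_bmean phi t : `|bmean phi t| <= bmean (fun x => `|phi x|) t.
Proof.
elim: t => //= l IHl r IHr; rewrite normrM [`|2^-1|]ger0_norm ?invr_ge0 //.
by rewrite ler_wpM2r ?invr_ge0 // (le_trans (ler_normD _ _)) // lerD.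
Qed.

End btree.
Arguments btree : clear implicits.

Section dyadic_tree.
Context {R : realType} {dim : nat} (omega : int -> 'I_dim -> bool).
Implicit Types (Q J : cidx dim) (l : seq 'I_dim) (e : {ffun 'I_dim -> bool}).

Let upd e (i : 'I_dim) : {ffun 'I_dim -> bool} := [ffun j => (j == i) || e j].

(** Each level halves one coordinate of [l], and [e] records the halves already chosen. Internal
    nodes below the root stand for boxes that are not lattice cubes, so only leaves carry an
    index. *)
Fixpoint split_tree Q (l : seq 'I_dim) e : btree (cidx dim) :=
  match l with
  | [::] => BLeaf (child omega Q e)
  | i :: l' => BNode (split_tree Q l' e) (split_tree Q l' (upd e i))
  end.

Lemma mem_split_tree Q l e J : uniq l -> all (fun j => ~~ e j) l ->
  J \in bleaves (split_tree Q l e) <->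
    exists2 e' : {ffun 'I_dim -> bool}, (forall j, j \notin l -> e' j = e j) & J = child omega Q e'.
Proof.
elim: l e => [|i l IH] e /=.
  move=> _ _; rewrite inE; split; first by move=> /eqP ->; exists e.
  by move=> [e' He ->]; apply/eqP; congr child; apply/ffunP => j; exact: He.
move=> /andP[il ul] /andP[ei le].
have le' : all (fun j => ~~ upd e i j) l.
  apply/allP => j jl; rewrite ffunE (negbTE (allP le _ jl)) orbF.
  by apply: contraNneq il => <-.
rewrite mem_cat; split.
  move=> /orP[/(IH _ ul le)|/(IH _ ul le')] [e' He ->]; exists e' => // j.
    by rewrite inE negb_or => /andP[_ jl]; exact: He.
  by rewrite inE negb_or => /andP[ji jl]; rewrite He // ffunE (negbTE ji).
move=> [e' He JE]; apply/orP.
case e'i : (e' i); [right; apply/(IH _ ul le')|left; apply/(IH _ ul le)];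
    exists e' => // j jl; have [->|ji] := eqVneq j i.
- by rewrite ffunE eqxx.
- by rewrite ffunE (negbTE ji) /= He // inE negb_or ji.
- by rewrite e'i (negbTE ei).
- by rewrite He // inE negb_or ji.
Qed.

Lemma uniq_split_tree Q l e : uniq l -> all (fun j => ~~ e j) l ->
  uniq (bleaves (split_tree Q l e)).
Proof.
elim: l e => [|i l IH] e //= /andP[il ul] /andP[ei le].
have le' : all (fun j => ~~ upd e i j) l.
  apply/allP => j jl; rewrite ffunE (negbTE (allP le _ jl)) orbF.
  by apply: contraNneq il => <-.
rewrite cat_uniq !IH //= andbT; apply/hasPn => J.
move=> /(mem_split_tree _ _ ul le')[e1 He1 JE]; apply/negP.
move=> /(mem_split_tree _ _ ul le)[e2 He2]; rewrite JE => /child_inj E.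
by move: (He1 _ il) (He2 _ il); rewrite E ffunE eqxx (negbTE ei) => ->.
Qed.

Lemma perfect_split_tree Q l e : bperfect (size l) (split_tree Q l e).
Proof. by elim: l e => //= i l IH e; rewrite !IH. Qed.

Fixpoint dtree (n : nat) Q : btree (cidx dim) :=
  if n is n'.+1 then
    bbind (dtree n') (split_tree Q (enum 'I_dim) [ffun=> false])
  else BLeaf Q.

Let kids Q := bleaves (split_tree Q (enum 'I_dim) [ffun=> false]).

Let mem_kids Q J : J \in kids Q = (parent omega J == Q).
Proof.
have all0 : all (fun j => ~~ ([ffun=> false] : {ffun 'I_dim -> bool}) j) (enum 'I_dim).
  by apply/allP => j _; rewrite ffunE.
have H := mem_split_tree Q J (enum_uniq 'I_dim) all0.
rewrite /kids; apply/idP/eqP => [JQ|JQ].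
  by have [e _ ->] := H.1 JQ; exact: childK.
have [e E] := parentK omega J; apply: H.2; exists e; last by rewrite -JQ E.
by move=> j; rewrite mem_enum.
Qed.

Let uniq_kids Q : uniq (kids Q).
Proof.
apply: uniq_split_tree; first exact: enum_uniq.
by apply/allP => j _; rewrite ffunE.
Qed.

Lemma mem_dtree n Q J : J \in bleaves (dtree n Q) = (iter n (parent omega) J == Q).
Proof.
elim: n Q => [|n IH] Q /=; first by rewrite inE.
rewrite bleaves_bind; apply/flatten_mapP/eqP.
  move=> [Q']; rewrite -/(kids Q) mem_kids => /eqP <-.
  by rewrite /= IH => /eqP <-.
move=> JQ; exists (iter n (parent omega) J); rewrite -?/(kids Q) ?mem_kids ?JQ //=.
by rewrite IH.
Qed.

Lemma uniq_dtree n Q : uniq (bleaves (dtree n Q)).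
Proof.
elim: n Q => [|n IH] Q //=; rewrite bleaves_bind -/(kids Q).
elim: (kids Q) (uniq_kids Q) => //= K s IHs /andP[Ks us].
rewrite cat_uniq IH IHs // andbT /=; apply/hasPn => J /flatten_mapP[K' K's].
rewrite /= !mem_dtree => /eqP ->.
by apply: contraNneq Ks => <-.
Qed.

Lemma perfect_dtree n Q : bperfect (n * dim) (dtree n Q).
Proof.
elim: n Q => [|n IH] Q //=; rewrite mulSn; apply: bperfect_bind => //.
by have := perfect_split_tree Q (enum 'I_dim) [ffun=> false]; rewrite size_enum_ord.
Qed.

Lemma indic_cube_dtree n Q (x : pt R dim) :
  \1_(cube R omega Q) x = \sum_(J <- bleaves (dtree n Q)) \1_(cube R omega J) x :> R.
Proof.
pose J0 := locate omega (Q.1 - n%:Z) x.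
rewrite (eq_big_seq (fun J => (J == J0)%:R)); last first.
  move=> J; rewrite mem_dtree => /eqP JQ; rewrite ind_locate eq_sym /J0 -JQ iter_parent1.
  by rewrite addrK.
have J0Q : iter n (parent omega) J0 = locate omega Q.1 x.
  by rewrite iter_parent_locate subrK.
rewrite ind_locate -J0Q -mem_dtree; case: (boolP (J0 \in _)) => J0in.
  rewrite (bigD1_seq J0) ?uniq_dtree //= eqxx big1 ?addr0 // => J /negbTE ->//.
rewrite big_seq big1 // => J Jin; case: eqP => // JE.
by rewrite JE (negbTE J0in) in Jin.
Qed.

End dyadic_tree.

(** * Averages over cubes *)

Section real_integral.
Context {R : realType} {dim : nat}.
Implicit Types f g h : pt R dim -> R.

Definition mint f := (lebn dim).-integrable setT (EFin \o f).
Definition tint f : R := \int[lebn dim]_x f x.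

Lemma mint_measurable f : mint f -> measurable_fun setT f.
Proof. by move=> /measurable_int /measurable_EFinP. Qed.

Lemma mintD f g : mint f -> mint g -> mint (fun x => f x + g x).
Proof.
move=> mf mg; rewrite /mint (_ : _ \o _ = (EFin \o f) \+ (EFin \o g))%E //.
exact: integrableD.
Qed.

Lemma mintZ c f : mint f -> mint (fun x => c * f x).
Proof. by move=> mf; have := integrableZl measurableT c mf. Qed.

Lemma tintD f g : mint f -> mint g -> tint (fun x => f x + g x) = tint f + tint g.
Proof. by move=> mf mg; rewrite /tint RintegralD. Qed.

Lemma tintZ c f : mint f -> tint (fun x => c * f x) = c * tint f.
Proof. by move=> mf; rewrite /tint RintegralZl. Qed.

Lemma le_tint f g : mint f -> mint g -> (forall x, f x <= g x) -> tint f <= tint g.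
Proof. by move=> mf mg fg; apply: le_Rintegral. Qed.

Lemma tint_ge0 f : (forall x, 0 <= f x) -> 0 <= tint f.
Proof. by move=> f0; apply: Rintegral_ge0. Qed.

Lemma mint0 : mint (fun=> 0).
Proof. exact: integrable0. Qed.

Lemma tint0 : tint (fun=> 0) = 0.
Proof. by rewrite /tint /Rintegral integral0. Qed.

Lemma mint_sum (I : Type) (s : seq I) (F : I -> pt R dim -> R) :
  (forall i, mint (F i)) -> mint (fun x => \sum_(i <- s) F i x).
Proof.
move=> mF; elim: s => [|i s IH].
  by under eq_fun do rewrite big_nil; exact: mint0.
by under eq_fun do rewrite big_cons; exact: mintD.
Qed.

Lemma tint_sum (I : Type) (s : seq I) (F : I -> pt R dim -> R) :
  (forall i, mint (F i)) ->
  tint (fun x => \sum_(i <- s) F i x) = \sum_(i <- s) tint (F i).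
Proof.
move=> mF; elim: s => [|i s IH].
  by under eq_fun do rewrite big_nil; rewrite big_nil tint0.
under eq_fun do rewrite big_cons.
by rewrite tintD ?IH ?big_cons //; exact: mint_sum.
Qed.

Lemma le_mint f g : measurable_fun setT f -> mint g ->
  (forall x, `|f x| <= g x) -> mint f.
Proof.
move=> mf mg fg; apply: (le_integrable _ _ _ mg) => //.
  exact/measurable_EFinP.
by move=> x _ /=; rewrite lee_fin (le_trans (fg x)) // ler_norm.
Qed.

Lemma ler_norm_tint f : mint f -> `|tint f| <= tint (fun x => `|f x|).
Proof. by move=> mf; apply: le_normr_Rintegral. Qed.

Lemma mint_norm f : mint f -> mint (fun x => `|f x|).
Proof. by move=> mf; apply: integrable_norm. Qed.

Lemma intRfin f : measurable_fun setT f -> (forall x, 0 <= f x) ->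
  mint f <-> (intR (fun x => (f x)%:E) < +oo)%E.
Proof.
move=> mf f0; rewrite intRE; last 2 first.
- exact/measurable_EFinP.
- by move=> x; rewrite lee_fin.
have E : (\int[lebn dim]_x `|(EFin \o f) x| = \int[lebn dim]_x (f x)%:E)%E.
  by apply: eq_integral => x _; rewrite /= ger0_norm.
split => [/integrableP[_]|fin]; first by rewrite E.
by apply/integrableP; split; [exact/measurable_EFinP|rewrite E].
Qed.

Lemma intR_tint f : mint f -> (forall x, 0 <= f x) ->
  intR (fun x => (f x)%:E) = (tint f)%:E.
Proof.
move=> mf f0; rewrite intRE; last 2 first.
- by apply/measurable_EFinP; exact: mint_measurable mf.
- by move=> x; rewrite lee_fin.
by rewrite /tint /Rintegral fineK //; apply: integrable_fin_num.
Qed.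

Lemma intS_tint f : measurable_fun setT f -> fine (Defs.intS f) = tint f.
Proof. by move=> mf; rewrite intSE. Qed.

End real_integral.

Section averages.
Context {R : realType} {dim : nat} (omega : int -> 'I_dim -> bool).
Implicit Types (f g h w : pt R dim -> R) (Q J : cidx dim).

Local Notation ind Q := (\1_(cube R omega Q) : pt R dim -> R).

Definition loc f := measurable_fun setT f /\ forall Q, mint (fun x => f x * ind Q x).

Lemma measurable_ind Q : measurable_fun setT (ind Q).
Proof. exact: measurable_indic (measurable_cube _ _). Qed.

Lemma ind_ge0 Q x : 0 <= ind Q x.
Proof. by rewrite indicE ler0n. Qed.

Lemma mint_ind Q : mint (ind Q).
Proof.
apply/intRfin; [exact: measurable_ind|exact: ind_ge0|].
rewrite intRE; [|apply/measurable_EFinP; exact: measurable_ind|by move=> x; rewrite lee_fin ind_ge0].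
rewrite integral_indic ?setIT //; last exact: measurable_cube.
suff : (lebn dim (cube R omega Q) < +oo)%E by [].
by rewrite lebn_cube ltry.
Qed.

Lemma tint_ind Q : tint (ind Q) = vol R Q.
Proof.
rewrite /tint /Rintegral integral_indic ?setIT //; last exact: measurable_cube.
transitivity (fine (lebn dim (cube R omega Q))); first by [].
by rewrite lebn_cube.
Qed.

Lemma ind_le1 Q x : ind Q x <= 1.
Proof. by rewrite indicE lern1 leq_b1. Qed.

Lemma indM Q x : ind Q x * ind Q x = ind Q x.
Proof. by rewrite indicE; case: (x \in _); rewrite ?mulr1 ?mulr0. Qed.

Lemma avgE f Q : measurable_fun setT f ->
  avg omega f Q = (vol R Q)^-1 * tint (fun x => f x * ind Q x).
Proof.
move=> mf; rewrite /avg intS_tint //.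
by apply: measurable_funM => //; exact: measurable_ind.
Qed.

Lemma tint_avg f Q : measurable_fun setT f ->
  tint (fun x => f x * ind Q x) = vol R Q * avg omega f Q.
Proof. by move=> mf; rewrite avgE // mulVKf // gt_eqF // vol_gt0. Qed.

Lemma vol_iter_parent n J : vol R (iter n (parent omega) J) = 2 ^+ (n * dim) * vol R J.
Proof.
elim: n => [|n IH]; first by rewrite mul1r.
rewrite /vol /= sideS exprMn mulSn exprD -mulrA; congr (_ * _).
exact: IH.
Qed.

Lemma avg_dtree n f Q : loc f -> avg omega f Q = bmean (avg omega f) (dtree omega n Q).
Proof.
move=> [mf lf]; rewrite (bmean_perfect _ (perfect_dtree omega n Q)) avgE //.
have -> : (fun x => f x * ind Q x) =
    (fun x => \sum_(J <- bleaves (dtree omega n Q)) f x * ind J x).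
  by apply/funext => x; rewrite (indic_cube_dtree omega n) mulr_sumr.
rewrite tint_sum // !mulr_sumr; apply: eq_big_seq => J.
rewrite mem_dtree => /eqP <-; rewrite tint_avg // vol_iter_parent.
rewrite invfM -!mulrA; congr (_ * _); rewrite mulVKf // gt_eqF //; exact: vol_gt0.
Qed.

Lemma locZ c f : loc f -> loc (fun x => c * f x).
Proof.
move=> [mf lf]; split; first exact: measurable_funM.
by move=> Q; under eq_fun do rewrite -mulrA; exact: mintZ.
Qed.

Lemma avgZ c f Q : loc f -> avg omega (fun x => c * f x) Q = c * avg omega f Q.
Proof.
move=> lf; have [mcf _] := locZ c lf; case: lf => mf lf.
rewrite !avgE //; under eq_fun do rewrite -mulrA.
by rewrite tintZ // mulrCA.
Qed.

Lemma loc1 : loc (fun=> 1).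
Proof.
split; first exact: measurable_cst.
by move=> Q; under eq_fun do rewrite mul1r; exact: mint_ind.
Qed.

Lemma avg1 Q : avg omega (fun=> 1 : R) Q = 1.
Proof.
rewrite avgE; last exact: measurable_cst.
under eq_fun do rewrite mul1r.
by rewrite tint_ind mulVf // gt_eqF // vol_gt0.
Qed.

(** A vanishing integral would force [f = 0] almost everywhere on a cube of positive measure. *)
Lemma intR_ind_gt0 f Q : (forall x, 0 < f x) -> measurable_fun setT f ->
  (0 < intR (fun x => (f x * ind Q x)%:E))%E.
Proof.
move=> f0 mf; have mfQ : measurable_fun setT (fun x => f x * ind Q x).
  by apply: measurable_funM => //; exact: measurable_ind.
have fQ0 x : 0 <= f x * ind Q x by rewrite mulr_ge0 ?ind_ge0 // ltW.
rewrite intRE; [|exact/measurable_EFinP|by move=> x; rewrite lee_fin].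
rewrite lt0e integral_ge0 ?andbT => [|x _]; last by rewrite lee_fin.
apply/eqP => H0.
pose h x := f x * ind Q x.
have mh : measurable_fun setT (EFin \o h) by exact/measurable_EFinP.
have H := ae_eq_integral_abs (lebn dim) measurableT mh.
have {}H0 : (\int[lebn dim]_x `|(EFin \o h) x| = 0)%E.
  by rewrite -[RHS]H0; apply: eq_integral => x _; rewrite /= ger0_norm // fQ0.
have [N [mN N0 NP]] := H.1 H0.
have : (lebn dim (cube R omega Q) <= lebn dim N)%E.
  apply: le_measure; rewrite ?inE //; first exact: measurable_cube.
  move=> x Qx; apply: NP => /= /(_ I) [] /eqP.
  by rewrite /h indicE mem_set // mulr1 gt_eqF.
by rewrite N0 lebn_cube lee_fin leNgt vol_gt0.
Qed.

Lemma measurable_winv w : weight w -> measurable_fun setT (winv w).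
Proof.
move=> [mw w0]; have -> : winv w = fun x => w x `^ (-1).
  by apply/funext => x; rewrite powR_inv1 // ltW.
exact: measurableT_comp (measurable_powR _) mw.
Qed.

(** Both averages over a cube are positive in the extended reals, so a finite product leaves neither
    of them infinite. *)
Lemma A2_loc w : weight w -> (A2 omega w < +oo)%E -> loc w /\ loc (winv w).
Proof.
move=> [mw w0] Aw.
have iw0 x : 0 < winv w x by rewrite /winv invr_gt0.
have miw := measurable_winv (conj mw w0).
have H Q : (intR (fun x => (w x * ind Q x)%:E) < +oo)%E /\
           (intR (fun x => (winv w x * ind Q x)%:E) < +oo)%E.
  have : (wavg omega w Q * wavg omega (winv w) Q < +oo)%E.
    by apply: le_lt_trans Aw; apply: ereal_sup_ubound; exists Q.
  have := intR_ind_gt0 Q w0 mw; have := intR_ind_gt0 Q iw0 miw.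
  have v0 : (0 < (vol R Q)^-1) by rewrite invr_gt0 vol_gt0.
  rewrite /wavg.
  case: (intR _) => [a||] //; case: (intR _) => [b||] //; rewrite ?lte_fin => a0 b0.
  - by rewrite !ltry.
  - by rewrite gt0_muley ?lte_fin // gt0_mulye ?mule_gt0 ?lte_fin.
  - by rewrite [X in (_ * X)%E]gt0_muley ?lte_fin // gt0_muley ?mule_gt0 ?lte_fin.
  - by rewrite !gt0_muley ?lte_fin // ltxx.
have mM f Q : measurable_fun setT f -> measurable_fun setT (fun x => f x * ind Q x).
  by move=> mf; apply: measurable_funM => //; exact: measurable_ind.
split; split => // Q; apply/intRfin; rewrite ?(H Q).1 ?(H Q).2 //; try exact: mM.
- by move=> x; rewrite mulr_ge0 ?ind_ge0 // ltW.
- by move=> x; rewrite mulr_ge0 ?ind_ge0 // ltW.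
Qed.

Lemma wavgE w Q : loc w -> (forall x, 0 < w x) -> wavg omega w Q = (avg omega w Q)%:E.
Proof.
move=> [mw lw] w0; rewrite /wavg intR_tint ?avgE //.
by move=> x; rewrite mulr_ge0 ?ind_ge0 // ltW.
Qed.

Lemma A2_avg w Q : weight w -> (A2 omega w < +oo)%E ->
  avg omega w Q * avg omega (winv w) Q <= fine (A2 omega w).
Proof.
move=> ww Aw; have [lw liw] := A2_loc ww Aw.
have H : ((avg omega w Q * avg omega (winv w) Q)%:E <= A2 omega w)%E.
  apply: ereal_sup_ubound; exists Q => //; rewrite !wavgE //; last by case: ww.
  by move=> x; rewrite /winv invr_gt0; case: ww.
rewrite -lee_fin fineK //; apply/fin_numP; split; last by rewrite lt_eqF.
by apply/eqP => E; rewrite E in H.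
Qed.

Lemma avg_gt0 f Q : loc f -> (forall x, 0 < f x) -> 0 < avg omega f Q.
Proof.
move=> [mf lf] f0; rewrite avgE // mulr_gt0 ?invr_gt0 ?vol_gt0 //.
have := intR_ind_gt0 Q f0 mf; rewrite intR_tint // => x.
by rewrite mulr_ge0 ?ind_ge0 // ltW.
Qed.

(* The discriminant of [l |-> \int_Q (f - l / w)^2 w], which is nonnegative. *)
Lemma avg_cauchy_schwarz w f Q : (forall x, 0 < w x) -> loc (winv w) -> loc f ->
  mint (fun x => f x ^+ 2 * w x * ind Q x) ->
  avg omega f Q ^+ 2 / avg omega (winv w) Q <=
    (vol R Q)^-1 * tint (fun x => f x ^+ 2 * w x * ind Q x).
Proof.
move=> w0 li lf lF.
have v0 : 0 < avg omega (winv w) Q.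
  by apply: (avg_gt0 _ li) => x; rewrite /winv invr_gt0.
set l := avg omega f Q / avg omega (winv w) Q.
case: (lf) => mf mfQ; case: (li) => mi miQ.
have : 0 <= tint (fun x => f x ^+ 2 * w x * ind Q x +
     ((- 2 * l) * (f x * ind Q x) + l ^+ 2 * (winv w x * ind Q x))).
  apply: tint_ge0 => x; have := w0 x; rewrite /winv => wx.
  have -> : f x ^+ 2 * w x * ind Q x +
     ((- 2 * l) * (f x * ind Q x) + l ^+ 2 * ((w x)^-1 * ind Q x)) =
     (f x - l / w x) ^+ 2 * w x * ind Q x by field; rewrite gt_eqF.
  by apply: mulr_ge0; [apply: mulr_ge0; [exact: sqr_ge0|exact: ltW]|exact: ind_ge0].
have m1 := mintZ (- 2 * l) (mfQ Q); have m2 := mintZ (l ^+ 2) (miQ Q).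
rewrite (tintD lF (mintD m1 m2)) (tintD m1 m2) !tintZ // (tint_avg Q mf) (tint_avg Q mi).
move: (tint _) => F.
have := vol_gt0 (R := R) Q; move: v0 {m1 m2}; rewrite {}/l.
move: (avg omega (winv w) Q) (avg omega f Q) (vol R Q) => v a V v0 V0.
have -> : F + (-2 * (a / v) * (V * a) + (a / v) ^+ 2 * (V * v)) =
  V * (V^-1 * F - a ^+ 2 / v) by field; rewrite !gt_eqF.
by rewrite pmulr_rge0 // subr_ge0.
Qed.

(** Cauchy-Schwarz with [f = 1]. It provides the lower boundary [1 <= u v] of the Bellman domain. *)
Lemma A2_ge1 w Q : (forall x, 0 < w x) -> loc w -> loc (winv w) ->
  1 <= avg omega w Q * avg omega (winv w) Q.
Proof.
move=> w0 lw li.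
have v0 : 0 < avg omega (winv w) Q by apply: (avg_gt0 _ li) => x; rewrite /winv invr_gt0.
have E : (fun x => 1 ^+ 2 * w x * ind Q x) = (fun x => w x * ind Q x).
  by apply/funext => x; rewrite expr1n mul1r.
have := avg_cauchy_schwarz w0 li loc1 (Q := Q).
rewrite E -avgE; last by case: lw.
by rewrite avg1 expr1n => /(_ (lw.2 Q)); rewrite ler_pdivrMr.
Qed.

Lemma L2_mint w f : weight w -> inL2w w f -> mint (fun x => f x ^+ 2 * w x).
Proof.
move=> [mw w0] [mf fin]; apply/intRfin => //.
  by apply: measurable_funM => //; exact: measurable_funX.
by move=> x; rewrite mulr_ge0 ?sqr_ge0 // ltW.
Qed.

Lemma L2_loc w f : weight w -> loc (winv w) -> inL2w w f -> loc f.
Proof.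
move=> ww [_ li] lf; have := L2_mint ww lf; case: ww => mw w0; case: lf => mf _ lF.
split=> // Q; apply: (le_mint _ (mintD lF (li Q))).
  by apply: measurable_funM => //; exact: measurable_ind.
move=> x; rewrite normrM (ger0_norm (ind_ge0 _ _)) /winv.
have := ind_ge0 Q x; have := ind_le1 Q x; move: (ind Q x) => i i1 i0.
have wx := w0 x; rewrite -[f x ^+ 2]real_normK ?num_real //.
have := normr_ge0 (f x); move: `|f x| => a a0.
(* Completing the square bounds [|f|] on the cube by [f^2 w + 1 / w]; the remainder is nonnegative
   because the indicator value [i] lies in [[0, 1]]. *)
have -> : a ^+ 2 * w x + (w x)^-1 * i = a * i + ((a * w x - i / 2) ^+ 2 + i * (1 - i / 4)) / w x.
  by field; rewrite gt_eqF.
rewrite lerDl divr_ge0 ?(ltW wx) // addr_ge0 ?sqr_ge0 // mulr_ge0 //; lra.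
Qed.

End averages.

(** * Wittwer's inequality for finite trees *)

Section step_trees.
Context {R : realType}.
Local Notation X := (R * R * R)%type.
Implicit Types (t l r : btree X) (I J : cidx 1) (phi psi : X -> R) (x : pt R 1).

Local Notation ind Q := (\1_(cube R omega0 Q) : pt R 1 -> R).
Local Notation par := (parent omega0).

Definition leaf_w (y : X) : R := y.1.1.
Definition leaf_v (y : X) : R := (y.1.1)^-1.
Definition leaf_f (y : X) : R := y.1.2.
Definition leaf_g (y : X) : R := y.2.
Definition leaf_F (y : X) : R := leaf_f y ^+ 2 * leaf_w y.
Definition leaf_G (y : X) : R := leaf_g y ^+ 2 * leaf_v y.

Fixpoint stepf phi t I : pt R 1 -> R :=
  match t with
  | BLeaf y => fun x => phi y * ind I x
  | BNode l r => fun x => stepf phi l (child1 I) x + stepf phi r (child2 I) x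
  end.

(** Wittwer's sum over the nodes of the tree, divided by the length of the root interval; the
    factors [1/2] are the relative lengths of the children. *)
Fixpoint tree_variation t : R :=
  match t with
  | BLeaf _ => 0
  | BNode l r => `|bmean leaf_f l - bmean leaf_f r| * `|bmean leaf_g l - bmean leaf_g r|
                 + (tree_variation l + tree_variation r) / 2
  end.

Fixpoint pos_leaves t : Prop :=
  match t with
  | BLeaf y => 0 < leaf_w y
  | BNode l r => pos_leaves l /\ pos_leaves r
  end.

Definition admissible (K : R) t :=
  pos_leaves t /\ bnodes (fun t => bmean leaf_w t * bmean leaf_v t <= K) t.

Lemma child1E I : child1 I = child omega0 I [ffun=> false].
Proof.
by rewrite /child1 /child; congr pair; apply/ffunP => i; rewrite !ffunE /=; lia.
Qed.

Lemma child2E I : child2 I = child omega0 I [ffun=> true].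
Proof.
by rewrite /child2 /child; congr pair; apply/ffunP => i; rewrite !ffunE /=; lia.
Qed.

Lemma parent_child1 I : par (child1 I) = I. Proof. by rewrite child1E childK. Qed.
Lemma parent_child2 I : par (child2 I) = I. Proof. by rewrite child2E childK. Qed.

Lemma child12_neq I : child1 I != child2 I.
Proof.
apply/eqP; rewrite child1E child2E => /child_inj /ffunP /(_ ord0).
by rewrite !ffunE.
Qed.

Lemma parentP1 I J : par J = I -> J = child1 I \/ J = child2 I.
Proof.
move=> <-; have [e <-] := parentK omega0 J; rewrite childK child1E child2E.
case e0 : (e ord0); [right|left]; congr child; apply/ffunP => i;
  by rewrite (ord1 i) e0 ffunE.
Qed.

Lemma ind_parent J x : ind (par J) x * ind J x = ind J x.
Proof. exact: (ind_iter_parent omega0 1). Qed.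


Lemma ind_child I x : ind I x = ind (child1 I) x + ind (child2 I) x.
Proof.
have [E|E] := eqVneq (locate omega0 I.1 x) I; last first.
  have H J : par J = I -> ind J x = 0.
    by move=> JI; rewrite -ind_parent JI ind_locate (negbTE E) mul0r.
  by rewrite (H _ (parent_child1 I)) (H _ (parent_child2 I)) ind_locate (negbTE E) addr0.
rewrite !ind_locate E eqxx /=.
have := parent_locate omega0 (I.1 - 1) x; rewrite subrK E => /parentP1.
have := child12_neq I; move: (child1 I) (child2 I) => I1 I2 I12 [] ->.
  by rewrite eqxx (negbTE I12) addr0.
by rewrite eqxx eq_sym (negbTE I12) add0r.
Qed.

Lemma stepf_ind phi t I x : stepf phi t I x * ind I x = stepf phi t I x.
Proof.
elim: t I => [y|l IHl r IHr] I /=; first by rewrite -mulrA indM.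
rewrite mulrDl -IHl -IHr -!mulrA; congr (_ * _ + _ * _).
  by rewrite mulrC -{1}[I]parent_child1 ind_parent.
by rewrite mulrC -{1}[I]parent_child2 ind_parent.
Qed.

(** A point selects one leaf, the same for every [phi], so relations between step functions, such as
    [leaf_v] being the inverse of [leaf_w], can be checked on leaves. *)
Lemma stepf_at t I x : ind I x = 1 -> pos_leaves t ->
  exists2 y, 0 < leaf_w y & forall phi, stepf phi t I x = phi y.
Proof.
elim: t I => [y|l IHl r IHr] I /= Ix.
  by move=> y0; exists y => // phi; rewrite Ix mulr1.
move=> [pl pr]; have := ind_child I x; rewrite Ix.
rewrite [ind (child1 I) x]ind_locate [ind (child2 I) x]ind_locate.
case: eqP => E1; case: eqP => E2 /= H; try lra.
  have [|y y0 Hy] := IHl (child1 I) _ pl; first by rewrite ind_locate E1 eqxx.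
  exists y => // phi; rewrite Hy -[X in _ + X]stepf_ind.
  by rewrite [ind (child2 I) x]ind_locate; case: eqP => // _; rewrite mulr0 addr0.
have [|y y0 Hy] := IHr (child2 I) _ pr; first by rewrite ind_locate E2 eqxx.
exists y => // phi; rewrite Hy -[X in X + _]stepf_ind.
by rewrite [ind (child1 I) x]ind_locate; case: eqP => // _; rewrite mulr0 add0r.
Qed.

Lemma mint_stepf phi t I : mint (stepf phi t I).
Proof.
by elim: t I => [y|l IHl r IHr] I /=; [exact/mintZ/mint_ind|exact: mintD].
Qed.

Lemma vol_child1 I : vol R (child1 I) = vol R I / 2.
Proof.
rewrite -{2}[I]parent_child1 (vol_iter_parent omega0 1) mul1n expr1 /=.
by lra.
Qed.

Lemma vol_child2 I : vol R (child2 I) = vol R I / 2.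
Proof. by rewrite -vol_child1. Qed.

Lemma tint_stepf phi t I : tint (stepf phi t I) = vol R I * bmean phi t.
Proof.
elim: t I => [y|l IHl r IHr] I /=; first by rewrite tintZ ?mint_ind ?tint_ind 1?mulrC.
rewrite tintD; [|exact: mint_stepf..].
by rewrite IHl IHr vol_child1 vol_child2; lra.
Qed.

Definition agrees phi (F : pt R 1 -> R) t I :=
  measurable_fun setT F /\ forall x, F x * ind I x = stepf phi t I x.

Lemma agrees_avg phi F t I : agrees phi F t I -> avg omega0 F I = bmean phi t.
Proof.
move=> [mF E]; rewrite avgE //; under eq_fun do rewrite E.
by rewrite tint_stepf mulKf // gt_eqF // vol_gt0.
Qed.

Lemma stepf_child2_disj phi t I x : stepf phi t (child2 I) x * ind (child1 I) x = 0.
Proof.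
rewrite -stepf_ind -mulrA (ind_disjoint (n := 0)) ?mulr0 //=; first by rewrite addr0.
exact: child12_neq.
Qed.

Lemma stepf_child1_disj phi t I x : stepf phi t (child1 I) x * ind (child2 I) x = 0.
Proof.
rewrite -stepf_ind -mulrA (ind_disjoint (n := 0)) ?mulr0 //=; first by rewrite addr0.
by rewrite eq_sym child12_neq.
Qed.

Lemma agrees_left phi F l r I : agrees phi F (BNode l r) I -> agrees phi F l (child1 I).
Proof.
move=> [mF E]; split => // x; rewrite -ind_parent parent_child1 mulrA E /=.
by rewrite mulrDl stepf_child2_disj addr0 stepf_ind.
Qed.

Lemma agrees_right phi F l r I : agrees phi F (BNode l r) I -> agrees phi F r (child2 I).
Proof.
move=> [mF E]; split => // x; rewrite -ind_parent parent_child2 mulrA E /=.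
by rewrite mulrDl stepf_child1_disj add0r stepf_ind.
Qed.

Lemma agrees_leaf phi F y n I J : agrees phi F (BLeaf y) I -> iter n par J = I ->
  avg omega0 F J = phi y.
Proof.
move=> [mF E] JI; rewrite avgE //.
have -> : (fun x => F x * ind J x) = (fun x => phi y * ind J x).
  by apply/funext => x; rewrite -(ind_iter_parent omega0 n) JI mulrA E /= -mulrA.
by rewrite tintZ ?mint_ind // tint_ind mulrC mulfK // gt_eqF // vol_gt0.
Qed.

(** An interval inside [I] is either a node of the tree, where the bound is part of admissibility,
    or lies in a leaf, where [W] and [V] are constant and reciprocal and the product is 1. *)
Lemma agrees_A2 K W V t n I J : 1 <= K -> admissible K t ->
  agrees leaf_w W t I -> agrees leaf_v V t I -> iter n par J = I ->
  avg omega0 W J * avg omega0 V J <= K.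
Proof.
move=> K1; elim: t n I => [y|l IHl r IHr] n I [].
  move=> /= y0 _ aW aV JI; rewrite (agrees_leaf aW JI) (agrees_leaf aV JI).
  by rewrite /leaf_v mulfV // gt_eqF.
move=> [pl pr] [Kt [Kl Kr]] aW aV; case: n => [|n] /=.
  by move=> ->; rewrite (agrees_avg aW) (agrees_avg aV).
move=> /parentP1[] JI.
  by apply: (IHl n (child1 I)) => //; [exact: (agrees_left aW)|exact: (agrees_left aV)].
by apply: (IHr n (child2 I)) => //; [exact: (agrees_right aW)|exact: (agrees_right aV)].
Qed.

Definition wterm (F G : pt R 1 -> R) I : R :=
  `|avg omega0 F (child1 I) - avg omega0 F (child2 I)| *
  `|avg omega0 G (child1 I) - avg omega0 G (child2 I)| * vol R I.

(** The nodes are distinct dyadic intervals, so the variation is a finite sub-sum of Wittwer's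
    series of nonnegative terms. *)
Lemma variation_sum F G t I : agrees leaf_f F t I -> agrees leaf_g G t I ->
  exists s : seq (cidx 1), [/\ uniq s, forall J, J \in s -> exists n, iter n par J = I
    & \sum_(J <- s) wterm F G J = tree_variation t * vol R I].
Proof.
elim: t I => [y|l IHl r IHr] I aF aG.
  by exists [::]; split => //; rewrite big_nil mul0r.
have [s1 [u1 d1 S1]] := IHl _ (agrees_left aF) (agrees_left aG).
have [s2 [u2 d2 S2]] := IHr _ (agrees_right aF) (agrees_right aG).
exists (I :: s1 ++ s2); split.
- rewrite /= cat_uniq u1 u2 /= andbT; apply/andP; split.
    rewrite mem_cat; apply/negP => /orP[/d1|/d2] [n] /(congr1 fst);
    by rewrite iter_parent1 /=; lia.
  apply/hasPn => J /d2 [n2 E2]; apply/negP => /d1 [n1 E1].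
  have E : n1 = n2.
    by move: (congr1 fst E1) (congr1 fst E2); rewrite !iter_parent1 /=; lia.
  by have := child12_neq I; rewrite -E1 -E2 E eqxx.
- move=> J; rewrite inE mem_cat => /predU1P[->|/orP[/d1|/d2] [n E]]; first by exists 0%N.
    by exists n.+1; rewrite /= E parent_child1.
  by exists n.+1; rewrite /= E parent_child2.
rewrite big_cons big_cat /= S1 S2 vol_child1 vol_child2 /wterm.
rewrite (agrees_avg (agrees_left aF)) (agrees_avg (agrees_right aF)).
rewrite (agrees_avg (agrees_left aG)) (agrees_avg (agrees_right aG)).
by field.
Qed.

End step_trees.

(** * Extension of step weights to the whole line *)

Section wittwer_trees.
Context {R : realType}.
Local Notation X := (R * R * R)%type.
Implicit Types (t l r : btree X) (I J : cidx 1) (phi psi : X -> R) (x : pt R 1).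
Local Notation ind Q := (\1_(cube R omega0 Q) : pt R 1 -> R).
Local Notation par := (parent omega0).

Lemma bmean_w_gt0 t : pos_leaves t -> 0 < bmean (@leaf_w R) t.
Proof. by elim: t => //= l IHl r IHr [/IHl ? /IHr ?]; lra. Qed.

Lemma bmean_v_gt0 t : pos_leaves t -> 0 < bmean (@leaf_v R) t.
Proof.
elim: t => [y|l IHl r IHr] /=; first by rewrite /leaf_v invr_gt0.
by move=> [/IHl ? /IHr ?]; lra.
Qed.

Lemma bnodes_root (Y : Type) P (t : btree Y) : bnodes P t -> P t.
Proof. by case: t => [y|l r] []. Qed.

Definition unit_cube : cidx 1 := (0, [ffun=> 0]).

Lemma vol_unit_cube : vol R unit_cube = 1.
Proof. by rewrite /vol /side expr1 expr0z. Qed.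

(** Wittwer's inequality concerns weights on the whole line. The step function is continued by a
    constant, to be chosen so that intervals larger than the unit one do not raise the Muckenhoupt
    norm. *)
Definition extended phi t (c : R) x :=
  stepf phi t unit_cube x + c * (1 - ind unit_cube x).

Lemma measurable_extended phi t c : measurable_fun setT (extended phi t c).
Proof.
apply: measurable_funD; first exact: mint_measurable (mint_stepf _ _ _).
apply: measurable_funM => //; apply: measurable_funB => //.
exact: measurable_ind.
Qed.

Lemma extended_ind phi t c J x : extended phi t c x * ind J x =
  stepf phi t unit_cube x * ind J x + c * (ind J x - ind unit_cube x * ind J x).
Proof. by rewrite /extended; ring. Qed.

Lemma agrees_extended phi t c : agrees phi (extended phi t c) t unit_cube.
Proof.
split; first exact: measurable_extended.
by move=> x; rewrite extended_ind indM subrr mulr0 addr0 stepf_ind.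
Qed.

Lemma agrees_stepf phi t : agrees phi (stepf phi t unit_cube) t unit_cube.
Proof.
split; first exact: mint_measurable (mint_stepf _ _ _).
by move=> x; rewrite stepf_ind.
Qed.

Lemma extended_at t c x : pos_leaves t -> 0 < c ->
  exists2 y : X, 0 < leaf_w y /\ forall phi, stepf phi t unit_cube x = phi y * ind unit_cube x &
  extended (@leaf_w R) t c x = (if ind unit_cube x == 1 then leaf_w y else c) /\
  extended (@leaf_v R) t c^-1 x = (if ind unit_cube x == 1 then leaf_v y else c^-1).
Proof.
move=> pt0 c0; case: eqP => Ix.
  have [y y0 Hy] := stepf_at Ix pt0; exists y; rewrite /extended ?Hy Ix.
    by split => // phi; rewrite Hy mulr1.
  by rewrite subrr !mulr0 !addr0.
have Ix0 : ind unit_cube x = 0.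
  by move: Ix; rewrite ind_locate; case: eqP.
exists (1, 1, 1); rewrite /extended ?Ix0; first split => [|phi].
- exact: ltr01.
- by rewrite -stepf_ind Ix0 !mulr0.
- by rewrite -[stepf _ _ _ _]stepf_ind -[stepf (@leaf_v R) _ _ _]stepf_ind Ix0 !mulr0 !add0r subr0 !mulr1.
Qed.

Lemma extended_weight t c : pos_leaves t -> 0 < c -> weight (extended (@leaf_w R) t c).
Proof.
move=> pt0 c0; split; first exact: measurable_extended.
by move=> x; have [y [y0 _] [-> _]] := extended_at x pt0 c0; case: ifP.
Qed.

Lemma winv_extended t c : pos_leaves t -> 0 < c ->
  winv (extended (@leaf_w R) t c) = extended (@leaf_v R) t c^-1.
Proof.
move=> pt0 c0; apply/funext => x; rewrite /winv.
by have [y _ [-> ->]] := extended_at x pt0 c0; case: ifP.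
Qed.

Lemma loc_extended phi t c : loc omega0 (extended phi t c).
Proof.
split; first exact: measurable_extended.
move=> J; under eq_fun do rewrite extended_ind.
apply: mintD.
  apply: (le_mint _ (mint_norm (mint_stepf phi t unit_cube))).
    apply: measurable_funM; last exact: measurable_ind.
    exact: mint_measurable (mint_stepf _ _ _).
  move=> x; rewrite normrM (ger0_norm (ind_ge0 _ _ _)).
  by rewrite ler_piMr // ind_le1.
apply: mintZ; apply: (le_mint _ (mint_ind omega0 J)).
  apply: measurable_funB; first exact: measurable_ind.
  by apply: measurable_funM; exact: measurable_ind.
move=> x; rewrite [ind J x]ind_locate [ind unit_cube x]ind_locate.
by do 2 case: eqP => _ /=; rewrite ?mulr1 ?mulr0 ?subrr ?subr0 ?normr0 ?normr1 ?ler01.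
Qed.

Lemma avg_extended_above phi t c J n : iter n par unit_cube = J ->
  avg omega0 (extended phi t c) J = c + (vol R J)^-1 * (bmean phi t - c).
Proof.
move=> UJ; have IJ x : ind unit_cube x * ind J x = ind unit_cube x.
  by rewrite -UJ mulrC ind_iter_parent.
rewrite avgE; last exact: measurable_extended.
have -> : (fun x => extended phi t c x * ind J x) =
    (fun x => stepf phi t unit_cube x + (c * ind J x + - c * ind unit_cube x)).
  apply/funext => x; rewrite extended_ind IJ -stepf_ind -mulrA IJ stepf_ind.
  by ring.
have m1 := mintZ c (mint_ind (R := R) omega0 J).
have m2 := mintZ (- c) (mint_ind (R := R) omega0 unit_cube).
rewrite (tintD (mint_stepf _ _ _) (mintD m1 m2)) (tintD m1 m2) !tintZ; [|exact: mint_ind..].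
rewrite tint_stepf !tint_ind vol_unit_cube.
by field; rewrite gt_eqF // vol_gt0.
Qed.

Lemma avg_extended_disj phi t c J :
  (forall x, ind unit_cube x * ind J x = 0) ->
  avg omega0 (extended phi t c) J = c.
Proof.
move=> IJ; rewrite avgE; last exact: measurable_extended.
have -> : (fun x => extended phi t c x * ind J x) = (fun x => c * ind J x).
  apply/funext => x; rewrite extended_ind IJ -stepf_ind -mulrA IJ.
  by ring.
by rewrite tintZ ?mint_ind // tint_ind mulrC mulfK // gt_eqF // vol_gt0.
Qed.

Lemma cube_trichotomy J : [\/ exists n, iter n par J = unit_cube,
  exists n, iter n par unit_cube = J | forall x, ind unit_cube x * ind J x = 0].
Proof.
have [n [E|E]] : exists n, unit_cube.1 = J.1 + n%:Z \/ J.1 = unit_cube.1 + n%:Z.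
  exists `|J.1|%N; rewrite /=; lia.
  case: (eqVneq (iter n par J) unit_cube) => [|H]; first by constructor 1; exists n.
  by constructor 3 => x; apply: (ind_disjoint x E).
case: (eqVneq (iter n par unit_cube) J) => [|H]; first by constructor 2; exists n.
by constructor 3 => x; rewrite mulrC; apply: (ind_disjoint x E).
Qed.

Lemma vol_above J n : iter n par unit_cube = J -> 1 <= vol R J.
Proof.
by move=> <-; rewrite vol_iter_parent vol_unit_cube mulr1 exprn_ege1 // ler1n.
Qed.

(* With [c = sqrt (u / v)] and [p = u / c = c v >= 1], the averages over a cube
   of volume [1 / th] containing the unit cube are [c (th p + 1 - th)] and
   [(th p + 1 - th) / c], so extending [w] by [c] does not increase its norm. *)
Lemma A2_extended K t : 1 <= K -> admissible K t ->
  let u := bmean (@leaf_w R) t in let v := bmean (@leaf_v R) t in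
  forall J, avg omega0 (extended (@leaf_w R) t (Num.sqrt (u / v))) J *
            avg omega0 (extended (@leaf_v R) t (Num.sqrt (u / v))^-1) J <= K.
Proof.
move=> K1 At u v J; case: (At) => pt0 nt.
have u0 : 0 < u by exact: bmean_w_gt0.
have v0 : 0 < v by exact: bmean_v_gt0.
set c := Num.sqrt (u / v).
have c0 : 0 < c by rewrite sqrtr_gt0 divr_gt0.
case: (cube_trichotomy J) => [[n Jn]|[n Jn]|dJ].
- by apply: (agrees_A2 (t := t) (n := n) (I := unit_cube)) => //; exact: agrees_extended.
- rewrite !(avg_extended_above _ _ _ Jn) -/u -/v.
  have uvK : u * v <= K by exact: (bnodes_root nt).
  have cc : c * c * v = u by rewrite -expr2 sqr_sqrtr ?divfK ?gt_eqF // divr_ge0 ?ltW.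
  have uv1 : 1 <= u * v.
    have := A2_ge1 unit_cube (extended_weight pt0 c0).2 (loc_extended _ _ _).
    rewrite winv_extended // => /(_ (loc_extended _ _ _)).
    by rewrite (agrees_avg (agrees_extended _ _ _)) (agrees_avg (agrees_extended _ _ _)).
  have := vol_above Jn; set th := (vol R J)^-1 => V1.
  have th0 : 0 < th by rewrite invr_gt0 vol_gt0.
  have th1 : th <= 1 by rewrite /th invf_le1 // vol_gt0.
  set p := c * v.
  have pp : p ^+ 2 = u * v by rewrite -cc /p; ring.
  have p1 : 1 <= p.
    have p0 : 0 < p by rewrite mulr_gt0.
    by rewrite leNgt; apply/negP => p1; rewrite -pp in uv1; nra.
  have -> : (c + th * (u - c)) * (c^-1 + th * (v - c^-1)) = (th * p + 1 - th) ^+ 2.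
    by rewrite -cc /p; field; rewrite gt_eqF.
  apply: le_trans uvK; rewrite -pp.
  by rewrite ler_sqr ?nnegrE; nra.
- by rewrite !avg_extended_disj // mulfV // gt_eqF.
Qed.

(** The witness [a] is the actual Muckenhoupt norm of the extended weight. Replacing it by [K]
    requires [0 <= C], which is itself deduced from this lemma. *)
Lemma wittwer_tree_raw C K t : wittwer_const C -> 1 <= K -> admissible K t ->
  exists2 a, 1 <= a <= K & tree_variation t <=
    C * a * Num.sqrt (bmean (@leaf_F R) t) * Num.sqrt (bmean (@leaf_G R) t).
Proof.
move=> wC K1 At; have [pt0 nt] := At.
set c := Num.sqrt (bmean (@leaf_w R) t / bmean (@leaf_v R) t).
have c0 : 0 < c by rewrite sqrtr_gt0 divr_gt0 ?bmean_w_gt0 ?bmean_v_gt0.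
set W := extended (@leaf_w R) t c.
have wW : weight W := extended_weight pt0 c0.
have iW : winv W = extended (@leaf_v R) t c^-1 := winv_extended pt0 c0.
have lW : loc omega0 W := loc_extended _ _ _.
have liW : loc omega0 (winv W) by rewrite iW; exact: loc_extended.
have AK : (A2 omega0 W <= K%:E)%E.
  apply: ge_ereal_sup => _ [J _ <-].
  rewrite !wavgE //; [|by move=> x; rewrite /winv invr_gt0; case: wW|by case: wW].
  by rewrite lee_fin iW; exact: A2_extended.
have Aoo : (A2 omega0 W < +oo)%E by rewrite (le_lt_trans AK) // ltry.
have A1 : 1 <= fine (A2 omega0 W).
  by apply: le_trans (A2_avg unit_cube wW Aoo); apply: A2_ge1 => //; case: wW.
have Afin : (A2 omega0 W = (fine (A2 omega0 W))%:E).
  rewrite fineK // fin_numE; apply/andP; split; last by rewrite lt_eqF.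
  by apply/eqP => E; rewrite E /= ler10 in A1.
exists (fine (A2 omega0 W)); first by rewrite A1 -lee_fin -Afin.
set f := stepf (@leaf_f R) t unit_cube; set g := stepf (@leaf_g R) t unit_cube.
have fF x : f x ^+ 2 * W x = stepf (@leaf_F R) t unit_cube x.
  have [y [y0 Hy] [WE _]] := extended_at x pt0 c0.
  rewrite /f /W WE !Hy; case: eqP => Ix; first by rewrite Ix !mulr1.
  have -> : ind unit_cube x = 0 by move: Ix; rewrite ind_locate; case: eqP.
  by rewrite !mulr0 expr0n mul0r.
have gG x : g x ^+ 2 * winv W x = stepf (@leaf_G R) t unit_cube x.
  have [y [y0 Hy] [_ VE]] := extended_at x pt0 c0.
  rewrite iW /g VE !Hy; case: eqP => Ix; first by rewrite Ix !mulr1.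
  have -> : ind unit_cube x = 0 by move: Ix; rewrite ind_locate; case: eqP.
  by rewrite !mulr0 expr0n mul0r.
have nF : L2int W f = (bmean (@leaf_F R) t)%:E.
  rewrite /L2int; under eq_fun do rewrite fF.
  rewrite intR_tint ?tint_stepf ?vol_unit_cube ?mul1r //; first exact: mint_stepf.
  by move=> x; rewrite -fF mulr_ge0 ?sqr_ge0 // ltW //; case: wW.
have nG : L2int (winv W) g = (bmean (@leaf_G R) t)%:E.
  rewrite /L2int; under eq_fun do rewrite gG.
  rewrite intR_tint ?tint_stepf ?vol_unit_cube ?mul1r //; first exact: mint_stepf.
  by move=> x; rewrite -gG mulr_ge0 ?sqr_ge0 // /winv invr_ge0 ltW //; case: wW.
have mS phi : measurable_fun setT (stepf phi t unit_cube).
  exact: mint_measurable (mint_stepf _ _ _).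
have inF : inL2w W f by split; [exact: mS|rewrite nF ltry].
have inG : inL2w (winv W) g by split; [exact: mS|rewrite nG ltry].
have := wC W wW Aoo f g inF inG.
rewrite /L2norm nF nG Afin -!EFinM /= => H.
rewrite -lee_fin; apply: le_trans H.
have [s [us _ sE]] := variation_sum (agrees_stepf (@leaf_f R) t) (agrees_stepf (@leaf_g R) t).
apply: esum_ge; exists [set` s]; first by split => //; exact: finite_seq.
rewrite -fsbig_seq // -[tree_variation t]mulr1 -vol_unit_cube -sE -sumEFin.
by apply: lee_sum => J _; rewrite lexx.
Qed.

End wittwer_trees.

(** * The Bellman function *)

Section bellman.
Context {R : realType}.
Local Notation X := (R * R * R)%type.
Implicit Types (t l r : btree X) (C K u v f g : R).

Lemma bmean_F_ge0 t : pos_leaves t -> 0 <= bmean (@leaf_F R) t.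
Proof.
elim: t => [y|l IHl r IHr] /=; last by move=> [/IHl ? /IHr ?]; lra.
by move=> /ltW y0; rewrite mulr_ge0 // sqr_ge0.
Qed.

Lemma bmean_G_ge0 t : pos_leaves t -> 0 <= bmean (@leaf_G R) t.
Proof.
elim: t => [y|l IHl r IHr] /=; last by move=> [/IHl ? /IHr ?]; lra.
by move=> /ltW y0; rewrite mulr_ge0 ?sqr_ge0 // /leaf_v invr_ge0.
Qed.

(** A single leaf has zero variation and nonzero energies, so the inequality reads [0 <= C a] with
    [a >= 1]. *)
Lemma wittwer_const_ge0 C : wittwer_const C -> 0 <= C.
Proof.
move=> wC; pose t : btree X := BLeaf (1, 1, 1).
have At : admissible 1 t.
  by split; [exact: ltr01|rewrite /= /leaf_w /leaf_v /= invr1 mulr1].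
have [a /andP[a1 _] /=] := wittwer_tree_raw wC (lexx 1) At.
rewrite /leaf_F /leaf_G /leaf_f /leaf_g /leaf_w /leaf_v /= invr1 expr1n mulr1 sqrtr1 !mulr1.
by rewrite pmulr_lge0 // (lt_le_trans ltr01).
Qed.

(** Passing from the product of the norms to half the sum of their squares makes the right side
    additive along the tree. It can then be subtracted inside a supremum, and the Bellman function
    needs no variables for the energies. *)
Lemma wittwer_tree C K t : wittwer_const C -> 1 <= K -> admissible K t ->
  tree_variation t <= C * K / 2 * (bmean (@leaf_F R) t + bmean (@leaf_G R) t).
Proof.
move=> wC K1 At; have C0 := wittwer_const_ge0 wC.
have [a /andP[a1 aK] /le_trans->//] := wittwer_tree_raw wC K1 At.
have F0 := bmean_F_ge0 At.1; have G0 := bmean_G_ge0 At.1.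
rewrite -{2}(sqr_sqrtr F0) -{2}(sqr_sqrtr G0).
move: (sqrtr_ge0 (bmean (@leaf_F R) t)) (sqrtr_ge0 (bmean (@leaf_G R) t)).
move: (Num.sqrt _) (Num.sqrt _) => p q p0 q0.
have pq0 : 0 <= p * q by rewrite mulr_ge0.
have : C * a * (p * q) <= C * K * (p * q).
  by apply: ler_wpM2r => //; apply: ler_wpM2l.
have : 0 <= C * K * (p - q) ^+ 2.
  apply: mulr_ge0; last exact: sqr_ge0.
  by apply: mulr_ge0 => //; exact: le_trans ler01 K1.
by move=> h1 h2; rewrite -mulrA [q * p]mulrC; apply: (le_trans h2); lra.
Qed.

Definition bdom K u v := [/\ 0 < u, 0 < v, 1 <= u * v & u * v <= K].

(** Leaf weights [u + D] and [u - D] with [D^2 = u^2 - u / v] have mean [u] and mean inverse [v].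
    Taking [f] proportional to [1/w] and [g] to [w] is the equality case of Cauchy-Schwarz, which
    gives the least energies. The supremum defining [B] is thus over a nonempty set, with the
    desired lower bound. *)
Lemma two_leaf_tree K u v f g : bdom K u v -> exists2 t, admissible K t &
  [/\ [/\ bmean (@leaf_w R) t = u, bmean (@leaf_v R) t = v, bmean (@leaf_f R) t = f &
       bmean (@leaf_g R) t = g],
     bmean (@leaf_F R) t = f ^+ 2 / v, bmean (@leaf_G R) t = g ^+ 2 / u & 0 <= tree_variation t].
Proof.
move=> [u0 v0 uv1 uvK].
have D0 : 0 <= u ^+ 2 - u / v.
  have -> : u ^+ 2 - u / v = u * (u * v - 1) / v by field; rewrite gt_eqF.
  by rewrite divr_ge0 ?(ltW v0) // mulr_ge0 ?(ltW u0) // subr_ge0.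
set D := Num.sqrt (u ^+ 2 - u / v).
have DD : D ^+ 2 = u ^+ 2 - u / v by rewrite sqr_sqrtr.
have D1 : 0 <= D := sqrtr_ge0 _.
move: D DD D1 {D0} => D DD D1.
have uv' : 0 < u / v by rewrite divr_gt0.
have Du : D < u by rewrite ltNge; apply/negP => ?; nra.
have a0 : 0 < u + D by lra.
have b0 : 0 < u - D by lra.
have vE : v = u / ((u + D) * (u - D)).
  have -> : (u + D) * (u - D) = u / v by rewrite -[RHS]opprK -[- (u / v)](addKr (u ^+ 2)) -DD; ring.
  by field; rewrite !gt_eqF.
exists (BNode (BLeaf (u + D, f / ((u + D) * v), g * (u + D) / u))
              (BLeaf (u - D, f / ((u - D) * v), g * (u - D) / u))).
  split; first by split.
  rewrite /= /leaf_w /leaf_v /=; split; last first.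
    by rewrite !mulfV ?gt_eqF //; split; split => //; exact: le_trans uv1 uvK.
  apply: le_trans uvK; rewrite vE le_eqVlt; apply/orP; left; apply/eqP.
  by field; rewrite !gt_eqF.
rewrite /= /leaf_F /leaf_G /leaf_w /leaf_v /leaf_f /leaf_g /=.
split; [split| | |].
- by field.
- by rewrite [RHS]vE; field; rewrite !gt_eqF.
- by rewrite vE; field; rewrite !gt_eqF.
- by field; rewrite gt_eqF.
- by rewrite vE; field; rewrite !gt_eqF.
- by field; rewrite !gt_eqF.
- by rewrite addr0 mul0r addr0 mulr_ge0.
Qed.

(** [B] is the supremum of variation minus energy over admissible trees with prescribed root
    averages. Joining two trees under a new root averages every quantity except the variation, which
    also gains the root term; the last [bdom] hypothesis makes the new node admissible. *)
Lemma bellman_exists C K : wittwer_const C -> 1 <= K ->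
  exists B : R -> R -> R -> R -> R,
    [/\ forall u v f g, bdom K u v -> B u v f g <= 0,
        forall u v f g, bdom K u v ->
          - (C * K / 2 * (f ^+ 2 / v + g ^+ 2 / u)) <= B u v f g &
        forall u1 v1 f1 g1 u2 v2 f2 g2, bdom K u1 v1 -> bdom K u2 v2 ->
          bdom K ((u1 + u2) / 2) ((v1 + v2) / 2) ->
          (B u1 v1 f1 g1 + B u2 v2 f2 g2) / 2 + `|f1 - f2| * `|g1 - g2| <=
          B ((u1 + u2) / 2) ((v1 + v2) / 2) ((f1 + f2) / 2) ((g1 + g2) / 2)].
Proof.
move=> wC K1.
pose S u v f g := [set s : R | exists2 t, admissible K t &
  [/\ bmean (@leaf_w R) t = u, bmean (@leaf_v R) t = v, bmean (@leaf_f R) t = f &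
      bmean (@leaf_g R) t = g] /\
  s = tree_variation t - C * K / 2 * (bmean (@leaf_F R) t + bmean (@leaf_G R) t)].
have S0 u v f g : ubound (S u v f g) 0.
  by move=> _ [t At [_ ->]]; rewrite subr_le0; exact: wittwer_tree.
have hS u v f g : has_ubound (S u v f g) by exists 0.
have neS u v f g : bdom K u v -> S u v f g !=set0 /\
    - (C * K / 2 * (f ^+ 2 / v + g ^+ 2 / u)) <= sup (S u v f g).
  move=> /(two_leaf_tree f g)[t At [H FE GE V0]].
  have St : S u v f g (tree_variation t - C * K / 2 * (bmean (@leaf_F R) t + bmean (@leaf_G R) t)).
    by exists t.
  split; first by eexists; exact: St.
  by apply: le_trans (ub_le_sup (hS _ _ _ _) St); rewrite FE GE lerDr.
exists (fun u v f g => sup (S u v f g)); split.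
- by move=> u v f g /(neS _ _ f g)[ne _]; apply: ge_sup.
- by move=> u v f g /(neS _ _ f g)[].
move=> u1 v1 f1 g1 u2 v2 f2 g2 d1 d2 d; set b := sup (S (_ / 2) _ _ _).
have [ne1 _] := neS _ _ f1 g1 d1; have [ne2 _] := neS _ _ f2 g2 d2.
suff H s1 s2 : S u1 v1 f1 g1 s1 -> S u2 v2 f2 g2 s2 ->
    (s1 + s2) / 2 + `|f1 - f2| * `|g1 - g2| <= b.
  suff : sup (S u1 v1 f1 g1) <= 2 * (b - `|f1 - f2| * `|g1 - g2|) - sup (S u2 v2 f2 g2) by lra.
  apply: ge_sup => // s1 Hs1.
  suff : sup (S u2 v2 f2 g2) <= 2 * (b - `|f1 - f2| * `|g1 - g2|) - s1 by lra.
  by apply: ge_sup => // s2 Hs2; have := H _ _ Hs1 Hs2; lra.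
move=> [t1 [p1 n1] [[uE1 vE1 fE1 gE1] ->]] [t2 [p2 n2] [[uE2 vE2 fE2 gE2] ->]].
apply: (ub_le_sup (hS _ _ _ _)); exists (BNode t1 t2).
  split => //=; split; last by split.
  by rewrite uE1 uE2 vE1 vE2; case: d.
by rewrite /= uE1 uE2 vE1 vE2 fE1 fE2 gE1 gE2; split => //; lra.
Qed.

End bellman.

(** * From midpoint concavity to concavity along segments *)

Section concavity.
Context {R : realType}.
Implicit Types (C K u v f g s t : R).

(* Subtracting the chord, the infimum [m] of [phi] satisfies [m >= m / 2]. *)
Lemma midpoint_concave (phi : R -> R) (m : R) :
  (forall t, 0 <= t <= 1 -> m <= phi t) ->
  (forall s t, 0 <= s <= 1 -> 0 <= t <= 1 -> (phi s + phi t) / 2 <= phi ((s + t) / 2)) ->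
  forall t, 0 <= t <= 1 -> (1 - t) * phi 0 + t * phi 1 <= phi t.
Proof.
move=> mphi mid.
pose psi t := phi t - ((1 - t) * phi 0 + t * phi 1).
pose S := [set psi t | t in [set t | 0 <= t <= 1]].
have lbS : has_lbound S.
  exists (m - `|phi 0| - `|phi 1|) => _ [t /= t01 <-]; have := mphi t t01.
  have := ler_norm (phi 0); have := ler_norm (phi 1).
  have := normr_ge0 (phi 0); have := normr_ge0 (phi 1).
  by rewrite /psi; move: t01 => /andP[? ?]; nra.
have ge_inf t : 0 <= t <= 1 -> inf S <= psi t.
  by move=> t01; apply: ge_inf => //; exists t.
have half t : 0 <= t <= 1 -> inf S / 2 <= psi t.
  move=> t01; have [t2|t2] := leP t 2^-1.
    have u01 : 0 <= 2 * t <= 1 by move: t01 t2 => /andP[]; lra.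
    have := mid 0 (2 * t) _ u01; rewrite lexx ler01 => /(_ isT).
    have -> : (0 + 2 * t) / 2 = t by field.
    by have := ge_inf _ u01; rewrite /psi; lra.
  have u01 : 0 <= 2 * t - 1 <= 1 by move: t01 t2 => /andP[]; lra.
  have := mid (2 * t - 1) 1 u01; rewrite lexx ler01 => /(_ isT).
  have -> : (2 * t - 1 + 1) / 2 = t by field.
  by have := ge_inf _ u01; rewrite /psi; lra.
have inf0 : 0 <= inf S.
  suff : inf S / 2 <= inf S by lra.
  apply: lb_le_inf; first by exists (psi 0), 0 => //=; rewrite lexx ler01.
  by move=> _ [t t01 <-]; exact: half.
by move=> t /ge_inf; rewrite /psi; lra.
Qed.

Definition seg (a b t : R) := (1 - t) * a + t * b.

(** On a segment inside the domain [B] is midpoint concave and bounded below, and [midpoint_concave]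
    needs nothing more. That the segment stays inside is an assumption, since the domain is not
    convex. *)
Lemma bellman_concave C K (B : R -> R -> R -> R -> R) : 0 <= C -> 1 <= K ->
  (forall u v f g, bdom K u v ->
          - (C * K / 2 * (f ^+ 2 / v + g ^+ 2 / u)) <= B u v f g) ->
  (forall u1 v1 f1 g1 u2 v2 f2 g2, bdom K u1 v1 -> bdom K u2 v2 ->
          bdom K ((u1 + u2) / 2) ((v1 + v2) / 2) ->
          (B u1 v1 f1 g1 + B u2 v2 f2 g2) / 2 + `|f1 - f2| * `|g1 - g2| <=
          B ((u1 + u2) / 2) ((v1 + v2) / 2) ((f1 + f2) / 2) ((g1 + g2) / 2)) ->
  forall u1 v1 f1 g1 u2 v2 f2 g2,
  (forall t, 0 <= t <= 1 -> bdom K (seg u1 u2 t) (seg v1 v2 t)) ->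
  forall t, 0 <= t <= 1 ->
    (1 - t) * B u1 v1 f1 g1 + t * B u2 v2 f2 g2 <=
    B (seg u1 u2 t) (seg v1 v2 t) (seg f1 f2 t) (seg g1 g2 t).
Proof.
move=> C0 K1 lbB mid u1 v1 f1 g1 u2 v2 f2 g2 dom t t01.
have i0 : 0 <= (0 : R) <= 1 by rewrite lexx ler01.
have i1 : 0 <= (1 : R) <= 1 by rewrite lexx ler01.
have seg0 a b : seg a b 0 = a by rewrite /seg; ring.
have seg1 a b : seg a b 1 = b by rewrite /seg; ring.
have [u10 v10 _ _] : bdom K u1 v1 by have := dom 0 i0; rewrite !seg0.
have [u20 v20 _ _] : bdom K u2 v2 by have := dom 1 i1; rewrite !seg1.
pose phi t := B (seg u1 u2 t) (seg v1 v2 t) (seg f1 f2 t) (seg g1 g2 t).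
have -> : B u1 v1 f1 g1 = phi 0 by rewrite /phi !seg0.
have -> : B u2 v2 f2 g2 = phi 1 by rewrite /phi !seg1.
(* Crude bounds, uniform in [s]: their only purpose is a finite lower bound for [B] on the whole
   segment. *)
have segV (a b s : R) : 0 < a -> 0 < b -> 0 <= s <= 1 ->
    0 <= (seg a b s)^-1 <= a^-1 + b^-1.
  move=> a0 b0 /andP[s0 s1].
  have sp : 0 < seg a b s by rewrite /seg; nra.
  rewrite invr_ge0 (ltW sp) /=; have [ab|ba] := leP a b.
    rewrite (@le_trans _ _ a^-1) //; last by rewrite lerDl invr_ge0 ltW.
    by rewrite lef_pV2 ?posrE // /seg; nra.
  rewrite (@le_trans _ _ b^-1) //; last by rewrite lerDr invr_ge0 ltW.
  by rewrite lef_pV2 ?posrE // /seg; nra.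
have segX (a b s : R) : 0 <= s <= 1 -> 0 <= (seg a b s) ^+ 2 <= a ^+ 2 + b ^+ 2.
  move=> /andP[s0 s1]; rewrite sqr_ge0 /=.
  apply: (@le_trans _ _ ((1 - s) * a ^+ 2 + s * b ^+ 2)).
    rewrite -subr_ge0; have -> : (1 - s) * a ^+ 2 + s * b ^+ 2 - seg a b s ^+ 2 =
      s * (1 - s) * (a - b) ^+ 2 by rewrite /seg; ring.
    by apply: mulr_ge0; [apply: mulr_ge0 => //; rewrite subr_ge0|exact: sqr_ge0].
  by have := sqr_ge0 a; have := sqr_ge0 b; nra.
apply: (@midpoint_concave phi (- (C * K / 2 * ((f1 ^+ 2 + f2 ^+ 2) * (v1^-1 + v2^-1) +
   (g1 ^+ 2 + g2 ^+ 2) * (u1^-1 + u2^-1))))) => //.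
  move=> s s01; apply: le_trans (lbB _ _ _ _ (dom s s01)).
  rewrite lerN2; apply: ler_wpM2l; first by rewrite divr_ge0 // mulr_ge0 // (le_trans ler01 K1).
  have /andP[? ?] := segV _ _ _ u10 u20 s01; have /andP[? ?] := segV _ _ _ v10 v20 s01.
  have /andP[? ?] := segX f1 f2 _ s01; have /andP[? ?] := segX g1 g2 _ s01.
  by rewrite lerD // ler_pM.
move=> s r s01 r01.
have m01 : 0 <= (s + r) / 2 <= 1 by move: s01 r01 => /andP[? ?] /andP[? ?]; lra.
have segm a b : seg a b ((s + r) / 2) = (seg a b s + seg a b r) / 2 by rewrite /seg; field.
have := dom _ m01; rewrite /phi !segm => dm.
have := mid _ _ (seg f1 f2 s) (seg g1 g2 s) _ _ (seg f1 f2 r) (seg g1 g2 r) (dom _ s01) (dom _ r01) dm.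
apply: le_trans; rewrite lerDl mulr_ge0 //.
Qed.

End concavity.

(** * The main inequality for the Bellman function *)

Section gain.
Context {R : realType}.
Implicit Types (K u v f g s t A : R).

Definition midpoint_gain K (B : R -> R -> R -> R -> R) :=
  forall u1 v1 f1 g1 u2 v2 f2 g2, bdom K u1 v1 -> bdom K u2 v2 ->
    bdom K ((u1 + u2) / 2) ((v1 + v2) / 2) ->
    (B u1 v1 f1 g1 + B u2 v2 f2 g2) / 2 + `|f1 - f2| * `|g1 - g2| <=
    B ((u1 + u2) / 2) ((v1 + v2) / 2) ((f1 + f2) / 2) ((g1 + g2) / 2).

Definition segment_concave K (B : R -> R -> R -> R -> R) :=
  forall u1 v1 f1 g1 u2 v2 f2 g2,
  (forall t, 0 <= t <= 1 -> bdom K (seg u1 u2 t) (seg v1 v2 t)) ->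
  forall t, 0 <= t <= 1 ->
    (1 - t) * B u1 v1 f1 g1 + t * B u2 v2 f2 g2 <=
    B (seg u1 u2 t) (seg v1 v2 t) (seg f1 f2 t) (seg g1 g2 t).

(** The cross terms are compared by the arithmetic-geometric mean inequality. This is how the lower
    constraint [1 <= u v] passes to averages. *)
Lemma cauchy_step (x1 y1 x2 y2 p1 p2 : R) : 0 < x1 -> 0 < y1 -> 0 < x2 -> 0 < y2 ->
  0 <= p1 -> 0 <= p2 -> p1 ^+ 2 <= x1 * y1 -> p2 ^+ 2 <= x2 * y2 ->
  (p1 + p2) ^+ 2 <= (x1 + x2) * (y1 + y2).
Proof.
move=> x10 y10 x20 y20 p10 p20 h1 h2.
have a0 : 0 < x1 * y2 by rewrite mulr_gt0.
have b0 : 0 < x2 * y1 by rewrite mulr_gt0.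
have : 2 * (p1 * p2) <= x1 * y2 + x2 * y1.
  have q0 : 0 <= 2 * (p1 * p2) by rewrite !mulr_ge0.
  have s0 : 0 <= x1 * y2 + x2 * y1 by lra.
  rewrite -ler_sqr ?nnegrE //.
  have E : (p1 * p2) ^+ 2 <= (x1 * y2) * (x2 * y1).
    have -> : x1 * y2 * (x2 * y1) = (x1 * y1) * (x2 * y2) by ring.
    by rewrite exprMn; apply: ler_pM => //; exact: sqr_ge0.
  have := sqr_ge0 (x1 * y2 - x2 * y1).
  move: (x1 * y2) (x2 * y1) (p1 * p2) E => a b p E; rewrite exprMn.
  by nra.
by lra.
Qed.

(* The product along the segment is at most [9/8] times the bound, since
   [t (2 t - 1) + 4 t (1 - t) <= 9/8]. *)
Lemma segment_product A a1 b1 a2 b2 t : 0 <= t <= 1 ->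
  0 < a1 -> 0 < b1 -> 0 < a2 -> 0 < b2 ->
  a1 * b1 <= A -> a2 * b2 <= A -> (a1 + a2) / 2 * ((b1 + b2) / 2) <= A ->
  seg a1 a2 t * seg b1 b2 t <= 9 / 8 * A.
Proof.
move=> /andP[t0 t1] a10 b10 a20 b20 h1 h2 h.
have p1 : 0 < a1 * b1 by rewrite mulr_gt0.
have p2 : 0 < a2 * b2 by rewrite mulr_gt0.
have -> : seg a1 a2 t * seg b1 b2 t = (1 - t) ^+ 2 * (a1 * b1) + t ^+ 2 * (a2 * b2) +
    t * (1 - t) * ((a1 + a2) * (b1 + b2) - a1 * b1 - a2 * b2) by rewrite /seg; ring.
have {}h : (a1 + a2) * (b1 + b2) <= 4 * A by lra.
move: (a1 * b1) (a2 * b2) p1 p2 h1 h2 ((a1 + a2) * (b1 + b2)) h => p q p0 q0 pA qA m mA.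
have tt : 0 <= t * (1 - t) by rewrite mulr_ge0 // subr_ge0.
have m1 : t * (1 - t) * m <= t * (1 - t) * (4 * A) by rewrite ler_wpM2l.
have A0 : 0 < A by apply: lt_le_trans pA.
(* On each half one endpoint coefficient is nonpositive and its term is dropped. What remains falls
   short of [9/8 A] by [2 A (t - 1/4)^2], respectively [2 A (t - 3/4)^2]. *)
have [t2|t2] := leP t (1 / 2).
  have e1 : (1 - t) * (1 - 2 * t) * p <= (1 - t) * (1 - 2 * t) * A.
    by rewrite ler_wpM2l // mulr_ge0 //; lra.
  have e2 : 0 <= t * (1 - 2 * t) * q by rewrite !mulr_ge0 ?(ltW q0) //; lra.
  have e3 : 0 <= A * (t - 1 / 4) ^+ 2 by apply: mulr_ge0 (ltW A0) (sqr_ge0 _).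
  by nra.
have e1 : t * (2 * t - 1) * q <= t * (2 * t - 1) * A.
  by rewrite ler_wpM2l // mulr_ge0 //; lra.
have e2 : 0 <= (1 - t) * (2 * t - 1) * p by rewrite !mulr_ge0 ?(ltW p0) //; lra.
have e3 : 0 <= A * (t - 3 / 4) ^+ 2 by apply: mulr_ge0 (ltW A0) (sqr_ge0 _).
by nra.
Qed.

(* For the sign patterns [p], [q] of [a], [b], one of [p], [q], [(p + q) / 2] and
   [(p - q) / 2] correlates with both [a] and [b]. *)
Lemma common_sign_pattern (Y : Type) (a b : Y -> R) (T : btree Y) :
  exists2 al : Y -> R, forall y, -1 <= al y <= 1 &
    bmean (fun y => `|a y|) T * bmean (fun y => `|b y|) T / 5 <=
    `|bmean (fun y => al y * a y) T| * `|bmean (fun y => al y * b y) T|.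
Proof.
pose p y := Num.sg (a y); pose q y := Num.sg (b y).
have sg1 (z : R) : -1 <= Num.sg z <= 1 by case: sgrP => _; rewrite ?lexx ?ler0N1 ?ler01 //=; lra.
have nle c T' (h k : Y -> R) : (forall y, `|h y| <= k y) -> c = bmean h T' -> `|c| <= bmean k T'.
  by move=> hk ->; rewrite (le_trans (ler_norm_bmean _ _)) // le_bmean.
have sgle (z z' : R) : `|Num.sg z * z'| <= `|z'|.
  rewrite normrM normr_sg; case: (z == 0); rewrite ?mul0r ?mul1r //=.
have sgn (z : R) : Num.sg z * z = `|z| by rewrite [RHS]normrEsg.
set Da := bmean (fun y => `|a y|) T; set Db := bmean (fun y => `|b y|) T.
set s := bmean (fun y => q y * a y) T; set t := bmean (fun y => p y * b y) T.
have pa : bmean (fun y => p y * a y) T = Da by apply: eq_bmean => y; exact: sgn.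
have qb : bmean (fun y => q y * b y) T = Db by apply: eq_bmean => y; exact: sgn.
have Da0 : 0 <= Da by apply: bmean_ge0.
have Db0 : 0 <= Db by apply: bmean_ge0.
have sD : `|s| <= Da by apply: (nle _ T (fun y => q y * a y)) => // y; exact: sgle.
have tD : `|t| <= Db by apply: (nle _ T (fun y => p y * b y)) => // y; exact: sgle.
have [tl|ts] := leP (Db / 5) `|t|.
  exists p => [y|]; first exact: sg1.
  by rewrite pa -/t (ger0_norm Da0) -mulrA ler_wpM2l.
have [sl|ss] := leP (Da / 5) `|s|.
  exists q => [y|]; first exact: sg1.
  by rewrite qb -/s (ger0_norm Db0) mulrAC ler_wpM2r.
have pqE (c : R) (h : Y -> R) : bmean (fun y => (p y + c * q y) / 2 * h y) T =
    (bmean (fun y => p y * h y) T + c * bmean (fun y => q y * h y) T) / 2.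
  rewrite -[in RHS]bmeanZ -bmeanD mulrC -bmeanZ; apply: eq_bmean => y.
  by field.
have pq1 (c : R) y : c = 1 \/ c = -1 -> -1 <= (p y + c * q y) / 2 <= 1.
  have /andP[? ?] := sg1 (a y); have /andP[? ?] := sg1 (b y); rewrite /p /q.
  by case=> ->; rewrite ?mul1r ?mulN1r; apply/andP; split; lra.
move: ts ss; rewrite !ltr_norml => /andP[t1 t2] /andP[s1 s2].
have st : - (Da * Db / 25) <= s * t.
  have : `|s * t| <= (Da / 5) * (Db / 5).
    by rewrite normrM ler_pM // ler_norml; apply/andP; split; lra.
  by rewrite ler_norml => /andP[? _]; lra.
(* Now [|s| < Da / 5] and [|t| < Db / 5]. The sign in [(p + q) / 2] or [(p - q) / 2] is chosen to
   make the cross term harmless, which leaves at least [(1 - 1/25) / 4 = 6/25 > 1/5] of [Da Db]. *)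
have [x0|x0] := leP 0 (Da * t + s * Db).
  exists (fun y => (p y + 1 * q y) / 2) => [y|]; first by apply: pq1; left.
  rewrite !pqE pa qb -/s -/t !mul1r !ger0_norm; [|lra|lra].
  have -> : (Da + s) / 2 * ((t + Db) / 2) = (Da * Db + s * t + (Da * t + s * Db)) / 4 by field.
  have : 0 <= Da * Db by rewrite mulr_ge0.
  by lra.
exists (fun y => (p y + (-1) * q y) / 2) => [y|]; first by apply: pq1; right.
rewrite !pqE pa qb -/s -/t !mulN1r (@ger0_norm _ ((Da - s) / 2)); last by lra.
rewrite (@ler0_norm _ ((t - Db) / 2)); last by lra.
have -> : (Da - s) / 2 * - ((t - Db) / 2) = (Da * Db + s * t - (Da * t + s * Db)) / 4 by field.
have : 0 <= Da * Db by rewrite mulr_ge0.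
by lra.
Qed.

Section weighted_tree.
Context {Y : Type} (U V F G : Y -> R).
Hypotheses (U0 : forall y, 0 < U y) (V0 : forall y, 0 < V y)
  (UV1 : forall y, 1 <= U y * V y).
Implicit Types (T : btree Y) (rho : Y -> R).

Lemma bmean_rho_bounds rho (W : Y -> R) T : (forall y, 3 / 4 <= rho y <= 5 / 4) ->
  (forall y, 0 < W y) ->
  3 / 4 * bmean W T <= bmean (fun y => rho y * W y) T <= 5 / 4 * bmean W T.
Proof.
move=> rhoP W0; rewrite -!bmeanZ; apply/andP; split; apply: le_bmean => y;
  by have /andP[? ?] := rhoP y; rewrite ler_wpM2r // ltW.
Qed.

Lemma bmean_cauchy_schwarz rho T : (forall y, 0 < rho y) ->
  bmean rho T ^+ 2 <= bmean (fun y => rho y * U y) T * bmean (fun y => rho y * V y) T.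
Proof.
move=> rho0; elim: T => [y|l IHl r IHr] /=.
  rewrite mulrACA -expr2 ler_peMr ?sqr_ge0 //.
have H W T : (forall y, 0 < W y) -> 0 < bmean (fun y => rho y * W y) T.
  by move=> W0; apply: bmean_gt0 => y; rewrite mulr_gt0.
have := cauchy_step (H U l U0) (H V l V0) (H U r U0) (H V r V0)
  (bmean_ge0 l (fun y => ltW (rho0 y))) (bmean_ge0 r (fun y => ltW (rho0 y))) IHl IHr.
by move=> h; rewrite expr_div_n mulf_div; apply: ler_pM => //; rewrite ?sqr_ge0 //; lra.
Qed.

(** Jensen's inequality for the density [rho], one node at a time. The normalised average at a node
    divides the segment between those of its children according to their masses [ml] and [mr], in
    general not at the midpoint, so the whole segment has to be controlled. *)
Lemma concave_weighted_tree A B rho T :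
  segment_concave (4 * A) B -> (forall y, 3 / 4 <= rho y <= 5 / 4) ->
  bnodes (fun T => bmean U T * bmean V T <= A) T ->
  let m := bmean rho T in
  bmean (fun y => rho y * B (U y) (V y) (F y) (G y)) T <=
  m * B (bmean (fun y => rho y * U y) T / m) (bmean (fun y => rho y * V y) T / m)
        (bmean (fun y => rho y * F y) T / m) (bmean (fun y => rho y * G y) T / m).
Proof.
move=> Bc rhoP.
have rho0 y : 0 < rho y by have /andP[? _] := rhoP y; lra.
have mP T' : 3 / 4 <= bmean rho T' <= 5 / 4.
  by rewrite -[3 / 4](bmean_cst _ T') -[5 / 4](bmean_cst _ T'); apply/andP; split;
    apply: le_bmean => y; have /andP[] := rhoP y.
elim: T => [y|l IHl r IHr] /=.
  have r0 : rho y != 0 by rewrite gt_eqF.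
  by move=> _; rewrite ![rho y * _]mulrC !mulfK.
move=> [NA [nl nr]].
have := IHl nl; have := IHr nr => {IHl IHr} /=.
have Al := bnodes_root nl; have Ar := bnodes_root nr.
have /andP[l1 l2] := mP l; have /andP[r1 r2] := mP r.
have /andP[ul1 ul2] := bmean_rho_bounds l rhoP U0.
have /andP[ur1 ur2] := bmean_rho_bounds r rhoP U0.
have /andP[vl1 vl2] := bmean_rho_bounds l rhoP V0.
have /andP[vr1 vr2] := bmean_rho_bounds r rhoP V0.
have csl := bmean_cauchy_schwarz l rho0.
have csr := bmean_cauchy_schwarz r rho0.
have aul := bmean_gt0 l U0; have aur := bmean_gt0 r U0.
have avl := bmean_gt0 l V0; have avr := bmean_gt0 r V0.
move: (bmean (fun y => rho y * B _ _ _ _) l) (bmean (fun y => rho y * B _ _ _ _) r) => bl br.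
move: (bmean (fun y => rho y * F y) l) (bmean (fun y => rho y * F y) r) => fl fr.
move: (bmean (fun y => rho y * G y) l) (bmean (fun y => rho y * G y) r) => gl gr.
move: (bmean (fun y => rho y * U y) l) (bmean (fun y => rho y * U y) r)
  ul1 ul2 ur1 ur2 csl csr => ul ur ul1 ul2 ur1 ur2.
move: (bmean (fun y => rho y * V y) l) (bmean (fun y => rho y * V y) r)
  vl1 vl2 vr1 vr2 => vl vr vl1 vl2 vr1 vr2 csl csr.
move: (bmean rho l) (bmean rho r) l1 l2 r1 r2 csl csr => ml mr l1 l2 r1 r2 csl csr Hr Hl.
move: (bmean U l) (bmean U r) (bmean V l) (bmean V r)
  NA Al Ar aul aur avl avr ul1 ul2 ur1 ur2 vl1 vl2 vr1 vr2.
move=> a1 a2 b1 b2 NA Al Ar aul aur avl avr ul1 ul2 ur1 ur2 vl1 vl2 vr1 vr2.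
have ml0 : 0 < ml by lra. have mr0 : 0 < mr by lra.
have ul0 : 0 < ul by lra. have ur0 : 0 < ur by lra.
have vl0 : 0 < vl by lra. have vr0 : 0 < vr by lra.
set t := mr / (ml + mr).
have s0 : 0 < ml + mr by lra.
have t01 : 0 <= t <= 1.
  by rewrite /t divr_ge0 ?(ltW mr0) ?(ltW s0) //= ler_pdivrMr // mul1r; lra.
have segE x y : seg (x / ml) (y / mr) t = (x + y) / 2 / ((ml + mr) / 2).
  by rewrite /seg /t; field; rewrite !gt_eqF.
have dom s : 0 <= s <= 1 -> bdom (4 * A) (seg (ul / ml) (ur / mr) s) (seg (vl / ml) (vr / mr) s).
  move=> s01; have /andP[sge0 sle1] := s01.
  have Ul : 0 < ul / ml by rewrite divr_gt0. have Ur : 0 < ur / mr by rewrite divr_gt0.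
  have Vl : 0 < vl / ml by rewrite divr_gt0. have Vr : 0 < vr / mr by rewrite divr_gt0.
  (* [5/3] is [(5/4) / (3/4)]: the numerator grows by at most [5/4] and the mass is at least
     [3/4]. *)
  have ub (c m a : R) : 0 < m -> 3 / 4 <= m -> 0 < a -> c <= 5 / 4 * a -> c / m <= 5 / 3 * a.
    by move=> m0 m1 a0 ca; rewrite ler_pdivrMr //; nra.
  have segle (x y p q : R) : x <= 5 / 3 * p -> y <= 5 / 3 * q ->
      seg x y s <= 5 / 3 * seg p q s by move=> xp yq; rewrite /seg; nra.
  have seg0 (x y : R) : 0 < x -> 0 < y -> 0 < seg x y s.
    by move=> x0 y0; rewrite /seg; nra.
  have cl : 1 <= (ul / ml) * (vl / ml).
    by rewrite mulf_div ler_pdivlMr ?mulr_gt0 // mul1r -expr2.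
  have cr : 1 <= (ur / mr) * (vr / mr).
    by rewrite mulf_div ler_pdivlMr ?mulr_gt0 // mul1r -expr2.
  split; [exact: seg0|exact: seg0| |].
    (* The endpoints are set apart because [cauchy_step] asks for strictly positive data. *)
    have [->|sn0] := eqVneq s 0; first by rewrite /seg subr0 !mul1r !mul0r !addr0.
    have [->|sn1] := eqVneq s 1; first by rewrite /seg subrr !mul1r !mul0r !add0r.
    have sp : 0 < s by rewrite lt0r sn0.
    have s1p : 0 < 1 - s by rewrite subr_gt0 lt_neqAle sn1.
    have := cauchy_step (mulr_gt0 s1p Ul) (mulr_gt0 s1p Vl) (mulr_gt0 sp Ur)
      (mulr_gt0 sp Vr) (ltW s1p) (ltW sp).
    rewrite subrK expr1n /seg; apply.
      by rewrite mulrACA -expr2 ler_peMr ?sqr_ge0.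
    by rewrite mulrACA -expr2 ler_peMr ?sqr_ge0.
  have h := segment_product s01 aul avl aur avr Al Ar NA.
  have hu := segle _ _ _ _ (ub _ _ _ ml0 l1 aul ul2) (ub _ _ _ mr0 r1 aur ur2).
  have hv := segle _ _ _ _ (ub _ _ _ ml0 l1 avl vl2) (ub _ _ _ mr0 r1 avr vr2).
  have A0 : 0 < A by apply: lt_le_trans Al; rewrite mulr_gt0.
  have : seg (ul / ml) (ur / mr) s * seg (vl / ml) (vr / mr) s <=
     (5 / 3 * seg a1 a2 s) * (5 / 3 * seg b1 b2 s).
    by apply: ler_pM => //; apply: ltW; exact: seg0.
  by move/le_trans; apply; rewrite mulrACA; lra.
have := Bc _ _ (fl / ml) (gl / ml) _ _ (fr / mr) (gr / mr) dom _ t01.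
rewrite !segE => H.
have : (ml + mr) / 2 * ((1 - t) * B (ul / ml) (vl / ml) (fl / ml) (gl / ml) +
   t * B (ur / mr) (vr / mr) (fr / mr) (gr / mr)) =
   (ml * B (ul / ml) (vl / ml) (fl / ml) (gl / ml) + mr * B (ur / mr) (vr / mr) (fr / mr) (gr / mr)) / 2.
  by rewrite /t; field; rewrite gt_eqF.
move=> E; apply: (@le_trans _ _ ((ml * B (ul / ml) (vl / ml) (fl / ml) (gl / ml) +
   mr * B (ur / mr) (vr / mr) (fr / mr) (gr / mr)) / 2)); first by lra.
by rewrite -E; apply: ler_wpM2l => //; lra.
Qed.

Lemma bellman_gain A B T : midpoint_gain (4 * A) B -> segment_concave (4 * A) B ->
  bnodes (fun T => bmean U T * bmean V T <= A) T ->
  bmean (fun y => B (U y) (V y) (F y) (G y)) T +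
    bmean (fun y => `|F y - bmean F T|) T * bmean (fun y => `|G y - bmean G T|) T / 80 <=
  B (bmean U T) (bmean V T) (bmean F T) (bmean G T).
Proof.
move=> mid conc NA.
set f := bmean F T; set g := bmean G T.
have [al al1 alD] := common_sign_pattern (fun y => F y - f) (fun y => G y - g) T.
set m := bmean al T.
have m1 : -1 <= m <= 1.
  rewrite -[-1](bmean_cst _ T) -[X in _ <= _ <= X](bmean_cst _ T).
  by apply/andP; split; apply: le_bmean => y; have /andP[] := al1 y.
(* Since [|al - m| <= 2], the factor [1/8] keeps [rho] in [[3/4, 5/4]]; centering [al] makes the
   total mass 1. *)
pose rho (c : R) y := 1 + c / 8 * (al y - m).
have rhoP c : c = 1 \/ c = -1 -> forall y, 3 / 4 <= rho c y <= 5 / 4.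
  move=> c1 y; have /andP[? ?] := al1 y; have /andP[? ?] := m1; rewrite /rho.
  by case: c1 => ->; apply/andP; split; lra.
have rho1 c : bmean (rho c) T = 1.
  by rewrite /rho bmeanD bmean_cst bmeanZ bmeanD bmean_cst -/m subrr mulr0 addr0.
have rhoE c (W : Y -> R) : bmean (fun y => rho c y * W y) T =
    bmean W T + c / 8 * bmean (fun y => (al y - m) * W y) T.
  by rewrite -bmeanZ -bmeanD; apply: eq_bmean => y; rewrite /rho; ring.
(* The centering moves from [al] to [W], so the reweighting detects exactly the correlation of [al]
   with the oscillation of [W]. *)
have corr (W : Y -> R) : bmean (fun y => (al y - m) * W y) T =
    bmean (fun y => al y * (W y - bmean W T)) T.
  transitivity (bmean (fun y => al y * W y) T - m * bmean W T).
    rewrite -mulNr -bmeanZ -bmeanD; apply: eq_bmean => y; ring.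
  rewrite mulrC -mulNr -[in LHS]bmeanZ -bmeanD; apply: eq_bmean => y; ring.
have A0 : bmean U T * bmean V T <= A := bnodes_root NA.
have u0 := bmean_gt0 T U0; have v0 := bmean_gt0 T V0.
have dom c : c = 1 \/ c = -1 ->
    bdom (4 * A) (bmean (fun y => rho c y * U y) T) (bmean (fun y => rho c y * V y) T).
  move=> c1; have /andP[ul uu] := bmean_rho_bounds T (rhoP c c1) U0.
  have /andP[vl vu] := bmean_rho_bounds T (rhoP c c1) V0.
  split; [lra|lra| |].
    rewrite -[1](expr1n _ 2) -{1}(rho1 c); apply: bmean_cauchy_schwarz => y.
    by have /andP[? _] := rhoP c c1 y; lra.
  apply: (@le_trans _ _ ((5 / 4 * bmean U T) * (5 / 4 * bmean V T))).
    by apply: ler_pM => //; lra.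
  have : 0 < bmean U T * bmean V T by rewrite mulr_gt0.
  by rewrite mulrACA; lra.
have wt c : c = 1 \/ c = -1 -> _ := fun c1 => concave_weighted_tree conc (rhoP c c1) NA.
have w1 := wt 1 (or_introl erefl); have w2 := wt (-1) (or_intror erefl).
move: w1 w2; rewrite /= !rho1 !divr1 !mul1r => w1 w2.
have half (W : Y -> R) : (bmean (fun y => rho 1 y * W y) T +
    bmean (fun y => rho (-1) y * W y) T) / 2 = bmean W T.
  by rewrite !rhoE; lra.
have d1 := dom 1 (or_introl erefl); have d2 := dom (-1) (or_intror erefl).
have d : bdom (4 * A) ((bmean (fun y => rho 1 y * U y) T + bmean (fun y => rho (-1) y * U y) T) / 2)
    ((bmean (fun y => rho 1 y * V y) T + bmean (fun y => rho (-1) y * V y) T) / 2).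
  rewrite !half; split => //.
    have := bmean_cauchy_schwarz T (fun=> ltr01 : 0 < (1 : R)).
    by rewrite bmean_cst expr1n !bmeanZ !mul1r.
  by have := mulr_gt0 u0 v0; lra.
have := mid _ _ (bmean (fun y => rho 1 y * F y) T) (bmean (fun y => rho 1 y * G y) T)
  _ _ (bmean (fun y => rho (-1) y * F y) T) (bmean (fun y => rho (-1) y * G y) T) d1 d2 d.
rewrite !half -/f -/g; apply: le_trans; apply: lerD.
  rewrite -(half (fun y => B _ _ _ _)); lra.
rewrite !rhoE !corr -/f -/g.
(* The two reweighted averages differ by a quarter of the correlation; with the loss [1/5] of the
   sign pattern the gain is [(1/4)^2 / 5 = 1/80]. *)
have diff (x z : R) : x + 1 / 8 * z - (x + -1 / 8 * z) = z / 4 by field.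
rewrite !diff !normrM [`|4^-1|]ger0_norm ?invr_ge0 // mulrACA.
by move: alD; lra.
Qed.

End weighted_tree.
End gain.

(** * The embedding theorem *)

Section nodes.
Context {R : realType} {Y : Type} (U V : Y -> R).
Hypotheses (U0 : forall y, 0 < U y) (V0 : forall y, 0 < V y).
Implicit Types T : btree Y.

Lemma bnodes_bind (P : btree Y -> Prop) k T : (forall y, bnodes P (k y)) ->
  bnodes (fun S => P (bbind k S)) T -> bnodes P (bbind k T).
Proof.
by move=> Pk; elim: T => //= l IHl r IHr [? [? ?]]; split=> //; split; [exact: IHl|exact: IHr].
Qed.

Lemma eq_bnodes (P P' : btree Y -> Prop) T : (forall S, P S -> P' S) ->
  bnodes P T -> bnodes P' T.
Proof.
move=> PP'; elim: T => [y|l IHl r IHr] /= []; first by move=> /PP'.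
by move=> /PP' ? [? ?]; split=> //; split; [exact: IHl|exact: IHr].
Qed.

(** A positive average at most doubles from a node to its child, so the product grows by at most 4
    per level, that is [4^(h-1)] down to the last internal nodes. Leaves satisfy the bound [A]
    directly, which saves the last factor 4 and explains the exponent [2d - 2]. *)
Lemma bnodes_perfect h T (A M Z : R) : bperfect h T -> (forall y, U y * V y <= A) ->
  A <= M -> 0 <= Z -> ((0 < h)%N -> 4 ^+ h.-1 * Z <= M) -> bmean U T * bmean V T <= Z ->
  bnodes (fun T => bmean U T * bmean V T <= M) T.
Proof.
move=> + UVA AM; elim: h T Z => [|h IH] [y|l r] //= Z.
  by move=> _ _ _ _; split => //; exact: le_trans (UVA y) AM.
move=> /andP[pl pr] Z0 /(_ isT) ZM TZ.
have ul := bmean_gt0 l U0; have ur := bmean_gt0 r U0.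
have vl := bmean_gt0 l V0; have vr := bmean_gt0 r V0.
have hM : (0 < h)%N -> 4 ^+ h.-1 * (4 * Z) <= M.
  by case: (h) ZM => //= h'; rewrite exprSr mulrA.
split.
  apply: (le_trans TZ); apply: le_trans ZM.
  by rewrite ler_peMl // exprn_ege1 // ler1n.
have Z4 : 0 <= 4 * Z by rewrite mulr_ge0.
split; apply: (IH _ (4 * Z)) => //; nra.
Qed.

End nodes.

Section embedding.
Context {R : realType} {dim : nat} (omega : int -> 'I_dim -> bool).
Implicit Types (f g h w : pt R dim -> R) (Q J : cidx dim) (n : nat).
Local Notation ind Q := (\1_(cube R omega Q) : pt R dim -> R).
Local Notation par := (parent omega).

Definition osc n f Q : R :=
  bmean (fun J => `|avg omega f J - avg omega f Q|) (dtree omega n Q).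

(** Every generation starts again from genuine cubes, where the product is at most the Muckenhoupt
    norm, so the loss does not accumulate with [n]. *)
Lemma bnodes_dtree w n Q : (0 < dim)%N -> weight w -> (A2 omega w < +oo)%E ->
  bnodes (fun T => bmean (avg omega w) T * bmean (avg omega (winv w)) T <=
                   2 ^+ (2 * dim - 2) * fine (A2 omega w)) (dtree omega n Q).
Proof.
move=> d0 ww Aw; have [lw li] := A2_loc ww Aw; have [mw w0] := ww.
have i0 x : 0 < winv w x by rewrite /winv invr_gt0.
have U0 J := avg_gt0 J lw w0; have V0 J := avg_gt0 J li i0.
have UVA J := A2_avg J ww Aw.
set A := fine _ in UVA *; have A0 : 0 <= A by apply: le_trans (UVA Q); rewrite mulr_ge0 ?ltW.
have E : (2 ^+ (2 * dim - 2) : R) = 4 ^+ dim.-1.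
  by rewrite -[4]/((2 * 2)%:R) natrM -expr2 -exprM; congr (_ ^+ _); lia.
have M1 : A <= 2 ^+ (2 * dim - 2) * A by rewrite ler_peMl // exprn_ege1 // ler1n.
elim: n Q => [|n IH] Q /=; first by split => //; apply: le_trans (UVA Q) M1.
apply: bnodes_bind => //.
have pf := perfect_split_tree omega Q (enum 'I_dim) [ffun=> false].
rewrite size_enum_ord in pf.
have avgS f : loc omega f -> avg omega f Q =
    bmean (avg omega f) (split_tree omega Q (enum 'I_dim) [ffun=> false]).
  by move=> lf; rewrite (avg_dtree 1) //= bmean_bind.
have : bnodes (fun T => bmean (avg omega w) T * bmean (avg omega (winv w)) T <=
     2 ^+ (2 * dim - 2) * A) (split_tree omega Q (enum 'I_dim) [ffun=> false]).
  apply: (bnodes_perfect U0 V0 pf UVA M1 A0) => [_|]; first by rewrite E.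
  by rewrite -!avgS.
apply: eq_bnodes => T; rewrite !bmean_bind.
by rewrite (eq_bmean T (fun J => esym (avg_dtree n J lw)))
           (eq_bmean T (fun J => esym (avg_dtree n J li))).
Qed.

Lemma mint_mul_ind h Q : mint h -> mint (fun x => h x * ind Q x).
Proof.
move=> mh; apply: (le_mint _ (mint_norm mh)).
  by apply: measurable_funM; [exact: mint_measurable|exact: measurable_ind].
by move=> x; rewrite normrM (ger0_norm (ind_ge0 _ _ _)) ler_piMr // ind_le1.
Qed.

Lemma tint_dtree h n Q : mint h ->
  tint (fun x => h x * ind Q x) =
  \sum_(J <- bleaves (dtree omega n Q)) tint (fun x => h x * ind J x).
Proof.
move=> mh; rewrite -tint_sum => [|J]; last exact: mint_mul_ind.
congr tint; apply/funext => x.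
by rewrite (indic_cube_dtree omega n) mulr_sumr.
Qed.

Lemma vol_bmean (phi : cidx dim -> R) n Q : vol R Q * bmean phi (dtree omega n Q) =
  \sum_(J <- bleaves (dtree omega n Q)) vol R J * phi J.
Proof.
rewrite (bmean_perfect _ (perfect_dtree omega n Q)) mulrA mulr_sumr.
apply: eq_big_seq => J; rewrite mem_dtree => /eqP <-.
rewrite vol_iter_parent.
have : (2 : R) ^+ (n * dim) != 0 by rewrite expf_neq0 // pnatr_eq0.
by move: (2 ^+ (n * dim)) => p p0; field.
Qed.

(* The iterated parent map [iter j (iter n par)] indexes the nested generations of
   cubes of the same residue class mod [n]; a superadditive [Phi] collects the
   increments [e] of all of them. *)
Lemma superadditive_sum n (Phi e : cidx dim -> R) (s : seq (cidx dim)) m Q :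
  uniq s -> (forall Q, 0 <= Phi Q) -> (forall Q, 0 <= e Q) ->
  (forall Q, \sum_(J <- bleaves (dtree omega n Q)) Phi J + e Q <= Phi Q) ->
  \sum_(j < m) \sum_(J <- s | iter j (iter n par) J == Q) e J <= Phi Q.
Proof.
move=> us Phi0 e0 super; elim: m Q => [|m IH] Q; first by rewrite big_ord0.
rewrite big_ord_recl /=; apply: le_trans (super Q); rewrite addrC lerD //; last first.
  have [Qs|Qs] := boolP (Q \in s).
    by rewrite big_mkcond (bigD1_seq Q) //= eqxx big1 ?addr0 // => J /negbTE ->.
  rewrite big_seq_cond big1 // => J /andP[Js /eqP E].
  by rewrite E (negbTE Qs) in Js.
apply: (@le_trans _ _ (\sum_(K <- bleaves (dtree omega n Q)) \sum_(j < m)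
   \sum_(J <- s | iter j (iter n par) J == K) e J)); last exact: ler_sum.
rewrite exchange_big /=; apply: ler_sum => j _.
under [leRHS]eq_bigr do rewrite big_mkcond.
rewrite [leRHS]exchange_big /= big_mkcond; apply: ler_sum => J _.
case: ifP => [/eqP JQ|_]; last by apply: sumr_ge0 => K _; case: ifP.
set K := iter j _ J in JQ *.
have KQ : K \in bleaves (dtree omega n Q) by rewrite mem_dtree JQ.
rewrite (bigD1_seq K) ?uniq_dtree //= eqxx lerDl; apply: sumr_ge0 => L _.
by case: ifP.
Qed.

Lemma iter_iter_parent1 n j J : (iter j (iter n par) J).1 = J.1 + (j * n)%N%:Z.
Proof.
by elim: j => [|j IH] /=; rewrite ?addr0 // iter_parent1 IH; lia.
Qed.

(** Each cube is lifted by a multiple of [n] generations into one common window of [n] scales. The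
    scale [k] lies above the whole list, and the number of lifts is [(k - J.1) / n] rounded up. *)
Lemma top_cubes n (s : seq (cidx dim)) : (0 < n)%N ->
  exists (k : int) (j : cidx dim -> nat), forall J, J \in s ->
    k <= (iter (j J) (iter n par) J).1 < k + n%:Z.
Proof.
move=> n0; pose k : int := \sum_(J <- s) `|J.1|; exists k.
exists (fun J => (`|k - J.1| + n.-1) %/ n)%N => J Js.
have Jk : J.1 <= k.
  rewrite /k (big_rem J) //= (le_trans (ler_norm _)) // lerDl.
  exact: sumr_ge0.
rewrite iter_iter_parent1.
have := divn_eq (`|k - J.1| + n.-1)%N n; have := ltn_pmod (`|k - J.1| + n.-1)%N n0.
move: ((`|k - J.1| + n.-1) %/ n)%N ((`|k - J.1| + n.-1) %% n)%N => q r.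
move: (q * n)%N => p rn E; move: (k : int) (J.1 : int) Jk E => k' i ik E; lia.
Qed.

(** At most one cube of each scale contains [x]. The linear factor [n] of the final bound arises
    here. *)
Lemma sum_ind_le n (k : int) (s : seq (cidx dim)) x : uniq s ->
  (forall J, J \in s -> k <= J.1 < k + n%:Z) -> \sum_(J <- s) ind J x <= n%:R.
Proof.
move=> us sk.
apply: (@le_trans _ _ (\sum_(J <- s) \sum_(i < n) (locate omega (k + i%:Z) x == J)%:R)).
  rewrite big_seq [leRHS]big_seq; apply: ler_sum => J Js; rewrite ind_locate.
  case: eqP => [JE|]; last by rewrite sumr_ge0.
  have /andP[H1 H2] := sk _ Js.
  have iP : (absz (J.1 - k) < n)%N by move: (J.1 : int) H1 H2 => i; lia.
  rewrite (bigD1 (Ordinal iP)) //= (_ : k + (absz (J.1 - k))%:Z = J.1); last first.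
    by move: (J.1 : int) H1 => i; lia.
  by rewrite JE eqxx lerDl sumr_ge0.
rewrite exchange_big /=.
have -> : n%:R = \sum_(i < n) (1 : R) by rewrite sumr_const card_ord.
apply: ler_sum => i _.
have [Ls|Ls] := boolP (locate omega (k + i%:Z) x \in s).
  rewrite (bigD1_seq _ Ls us) /= eqxx big1 ?addr0 // => J /negbTE.
  by rewrite eq_sym => ->.
rewrite big_seq big1 // => J Js; case: eqP => // JE.
by rewrite JE Js in Ls.
Qed.

End embedding.

(** * Summation of the Bellman gain over all cubes of the shift *)

Section carleson.
Context {R : realType} {dim : nat} (omega : int -> 'I_dim -> bool).
Implicit Types (f g h w : pt R dim -> R) (Q J : cidx dim) (n : nat).
Local Notation ind Q := (\1_(cube R omega Q) : pt R dim -> R).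
Local Notation par := (parent omega).

Lemma winvK w : winv (winv w) = w.
Proof. by apply/funext => x; rewrite /winv invrK. Qed.

Lemma weight_winv w : weight w -> weight (winv w).
Proof.
move=> ww; split; first exact: measurable_winv.
by move=> x; rewrite /winv invr_gt0; case: ww.
Qed.

(** [m] exceeds every number of lifts, so each cube is counted at least once, under its own top;
    repeated counts are nonnegative. *)
Lemma sum_tops n (e : cidx dim -> R) (s tops : seq (cidx dim)) (j : cidx dim -> nat) :
  uniq tops -> (forall J, 0 <= e J) ->
  (forall J, J \in s -> iter (j J) (iter n par) J \in tops) ->
  exists m, \sum_(J <- s) e J <= \sum_(Q <- tops) \sum_(i < m)
    \sum_(J <- s | iter i (iter n par) J == Q) e J.
Proof.
move=> ut e0 st; exists (\max_(J <- s) j J).+1.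
have -> : \sum_(Q <- tops) \sum_(i < (\max_(J <- s) j J).+1)
      \sum_(J <- s | iter i (iter n par) J == Q) e J =
    \sum_(Q <- tops) \sum_(J <- s) \sum_(i < (\max_(J <- s) j J).+1)
      (if iter i (iter n par) J == Q then e J else 0).
  apply: eq_bigr => Q _; rewrite exchange_big /=; apply: eq_bigr => i _.
  by rewrite big_mkcond.
rewrite [leRHS]exchange_big /= big_seq [leRHS]big_seq; apply: ler_sum => J Js.
rewrite (bigD1_seq _ (st _ Js) ut) /=.
have jm : (j J < (\max_(J <- s) j J).+1)%N by rewrite ltnS (leq_bigmax_seq J).
rewrite (bigD1 (Ordinal jm)) //= eqxx -addrA lerDl addr_ge0 //.
  by apply: sumr_ge0 => i _; case: ifP.
by apply: sumr_ge0 => Q _; apply: sumr_ge0 => i _; case: ifP.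
Qed.

Lemma carleson_embedding C w n (s : seq (cidx dim)) f g :
  wittwer_const C -> (0 < dim)%N -> (0 < n)%N -> weight w -> (A2 omega w < +oo)%E ->
  uniq s -> inL2w w f -> inL2w (winv w) g ->
  \sum_(Q <- s) vol R Q * (osc omega n f Q * osc omega n g Q) <=
  160 * n%:R * C * (2 ^+ (2 * dim - 2) * fine (A2 omega w)) *
    (tint (fun x => f x ^+ 2 * w x) + tint (fun x => g x ^+ 2 * winv w x)).
Proof.
move=> wC d0 n0 ww Aw us Lf Lg; have [lw li] := A2_loc ww Aw.
have wi := weight_winv ww; have lwK : loc omega (winv (winv w)) by rewrite winvK.
have lf := L2_loc ww li Lf; have lg := L2_loc wi lwK Lg.
have mF := L2_mint ww Lf; have mG := L2_mint wi Lg.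
set A := 2 ^+ _ * _; pose K := 4 * A; pose c := C * K / 2.
have C0 := wittwer_const_ge0 wC.
have [_ w0] := ww; have [_ i0] := wi.
have UV1 Q := A2_ge1 Q w0 lw li; have UVA Q := A2_avg Q ww Aw.
have A1 : fine (A2 omega w) <= A.
  rewrite /A ler_peMl ?exprn_ege1 ?ler1n //.
  exact: le_trans ler01 (le_trans (UV1 (0, [ffun=> 0])) (UVA _)).
have A1' : 1 <= A by apply: le_trans A1; exact: le_trans (UV1 (0, [ffun=> 0])) (UVA _).
have K1 : 1 <= K by rewrite /K; lra.
have c0 : 0 <= c by rewrite /c divr_ge0 // mulr_ge0 // (le_trans ler01 K1).
have [B [Ble Bge Bmid]] := bellman_exists wC K1.
have Bconc := bellman_concave C0 K1 Bge Bmid.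
have U0 Q := avg_gt0 Q lw w0; have V0 Q := avg_gt0 Q li i0.
have dom Q : bdom K (avg omega w Q) (avg omega (winv w) Q).
  by split => //; apply: (le_trans (UVA Q)); rewrite /K; lra.
pose BX Q := B (avg omega w Q) (avg omega (winv w) Q) (avg omega f Q) (avg omega g Q).
(* The energy of [Q] compensates the negativity of [B], by its lower bound and Cauchy-Schwarz. Being
   additive over descendants, it leaves the superadditivity of the first term intact. *)
pose Phi Q := vol R Q * BX Q + c * (tint (fun x => f x ^+ 2 * w x * ind Q x) +
   tint (fun x => g x ^+ 2 * winv w x * ind Q x)).
pose e Q := vol R Q * (osc omega n f Q * osc omega n g Q / 80).
have osc0 h Q : 0 <= osc omega n h Q by exact: bmean_ge0.
have e0 Q : 0 <= e Q.
  by rewrite /e mulr_ge0 ?(ltW (vol_gt0 _)) // divr_ge0 // mulr_ge0.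
have Phi0 Q : 0 <= Phi Q.
  have cs1 := avg_cauchy_schwarz w0 li lf (mint_mul_ind omega Q mF).
  have cs2 := avg_cauchy_schwarz i0 lwK lg (mint_mul_ind omega Q mG).
  rewrite winvK in cs2.
  have v0 := vol_gt0 (R := R) Q.
  have := Bge _ _ (avg omega f Q) (avg omega g Q) (dom Q); rewrite -/c -/(BX Q) /Phi.
  move: cs1 cs2; move: (_ / avg omega (winv w) Q) (_ / avg omega w Q) (tint _) (tint _) (BX Q).
  move=> p q y x b h1 h2 h3.
  have {}h1 : vol R Q * p <= x by rewrite -ler_pdivlMl.
  have {}h2 : vol R Q * q <= y by rewrite -ler_pdivlMl.
  have h4 : vol R Q * - (c * (p + q)) <= vol R Q * b by rewrite ler_pM2l.
  have h5 : c * (vol R Q * p + vol R Q * q) <= c * (x + y) by rewrite ler_wpM2l // lerD.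
  by lra.
have PhiE Q : Phi Q <= c * (tint (fun x => f x ^+ 2 * w x * ind Q x) +
   tint (fun x => g x ^+ 2 * winv w x * ind Q x)).
  by rewrite /Phi gerDr mulr_ge0_le0 ?(ltW (vol_gt0 _)) //; exact: Ble.
have super Q : \sum_(J <- bleaves (dtree omega n Q)) Phi J + e Q <= Phi Q.
  rewrite big_split /= -vol_bmean -mulr_sumr big_split /= -!tint_dtree //.
  rewrite addrAC lerD2r /e -mulrDr ler_pM2l ?vol_gt0 //.
  have := bellman_gain (avg omega f) (avg omega g) U0 V0 UV1 Bmid Bconc (bnodes_dtree n Q d0 ww Aw).
  by rewrite -!avg_dtree.
have [k [j kj]] := top_cubes omega s n0.
pose tops := undup (map (fun J => iter (j J) (iter n par) J) s).
have utops : uniq tops := undup_uniq _.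
have st J : J \in s -> iter (j J) (iter n par) J \in tops.
  by move=> Js; rewrite mem_undup (map_f (fun J => iter (j J) (iter n par) J)).
have tk J : J \in tops -> k <= J.1 < k + n%:Z.
  by rewrite mem_undup => /mapP [J' /kj ? ->].
have [m Hm] := sum_tops utops e0 st.
have tot h : mint h -> (forall x, 0 <= h x) ->
    \sum_(Q <- tops) tint (fun x => h x * ind Q x) <= n%:R * tint h.
  move=> mh h0; rewrite -tint_sum; last by move=> Q; exact: mint_mul_ind.
  rewrite -tintZ //; apply: le_tint.
  - by apply: mint_sum => Q; exact: mint_mul_ind.
  - exact: mintZ.
  - by move=> x; rewrite -mulr_sumr mulrC ler_wpM2r //; exact: sum_ind_le utops tk.
have : \sum_(Q <- s) e Q <= c * (n%:R * tint (fun x => f x ^+ 2 * w x) +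
    n%:R * tint (fun x => g x ^+ 2 * winv w x)).
  apply: (le_trans Hm); apply: (@le_trans _ _ (\sum_(Q <- tops) Phi Q)).
    by apply: ler_sum => Q _; exact: superadditive_sum.
  apply: (@le_trans _ _ _ _ _ (ler_sum _ (fun Q _ => PhiE Q))).
  rewrite -mulr_sumr big_split /= ler_wpM2l // lerD //; apply: tot => // x.
    by rewrite mulr_ge0 ?sqr_ge0 // ltW.
  by rewrite mulr_ge0 ?sqr_ge0 // ltW.
have -> : \sum_(Q <- s) e Q =
    (\sum_(Q <- s) vol R Q * (osc omega n f Q * osc omega n g Q)) / 80.
  by rewrite mulr_suml; apply: eq_bigr => Q _; rewrite /e mulrA.
(* [80 c] with [c = C * (4 A) / 2] is the constant [160 C A]. *)
rewrite /c /K; move: (\sum_(Q <- s) _) (tint _) (tint _) => S x y; lra.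
Qed.

End carleson.

(** * Haar differences and duality *)

Section haar_differences.
Context {R : realType} {dim : nat} (omega : int -> 'I_dim -> bool).
Implicit Types (f g h k w : pt R dim -> R) (Q J : cidx dim) (n : nat).
Local Notation ind Q := (\1_(cube R omega Q) : pt R dim -> R).
Local Notation par := (parent omega).

(** A class containing every Haar difference, stable under finite sums and squares, and integrable
    against any locally integrable function. *)
Definition cubewise_bounded f := measurable_fun setT f /\
  exists (M : R) (s : seq (cidx dim)), 0 <= M /\
    forall x, `|f x| <= M * \sum_(J <- s) ind J x.

Lemma sum_ind_ge0 (s : seq (cidx dim)) x : 0 <= \sum_(J <- s) ind J x.
Proof. by apply: sumr_ge0 => J _; exact: ind_ge0. Qed.

Lemma cubewise_boundedD f g : cubewise_bounded f -> cubewise_bounded g ->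
  cubewise_bounded (fun x => f x + g x).
Proof.
move=> [mf [M [s [M0 fM]]]] [mg [M' [s' [M0' gM]]]].
split; first exact: measurable_funD.
exists (M + M'), (s ++ s'); split; first exact: addr_ge0.
move=> x; apply: (le_trans (ler_normD _ _)); rewrite big_cat /=.
have := sum_ind_ge0 s x; have := sum_ind_ge0 s' x; have := fM x; have := gM x.
by move: (\sum_(J <- s) _) (\sum_(J <- s') _) => a b; nra.
Qed.

Lemma cubewise_bounded0 : cubewise_bounded (fun=> 0).
Proof.
split; first exact: measurable_cst.
by exists 0, [::]; split => // x; rewrite normr0 mul0r.
Qed.

Lemma cubewise_bounded_sum (I : Type) (s : seq I) (F : I -> pt R dim -> R) :
  (forall i, cubewise_bounded (F i)) -> cubewise_bounded (fun x => \sum_(i <- s) F i x).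
Proof.
move=> bF; elim: s => [|i s IH].
  by under eq_fun do rewrite big_nil; exact: cubewise_bounded0.
by under eq_fun do rewrite big_cons; exact: cubewise_boundedD.
Qed.

Lemma cubewise_bounded_ind c J : cubewise_bounded (fun x => c * ind J x).
Proof.
split; first by apply: measurable_funM => //; exact: measurable_ind.
exists `|c|, [:: J]; split=> // x.
by rewrite big_seq1 normrM (ger0_norm (ind_ge0 _ _ _)).
Qed.

Lemma cubewise_bounded_sqr f : cubewise_bounded f -> cubewise_bounded (fun x => f x ^+ 2).
Proof.
move=> [mf [M [s [M0 fM]]]]; split; first exact: measurable_funX.
exists (M ^+ 2 * (size s)%:R), s; split; first by rewrite mulr_ge0 ?sqr_ge0.
move=> x; rewrite normrX; have S0 := sum_ind_ge0 s x.
have SN : \sum_(J <- s) ind J x <= (size s)%:R.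
  rewrite -sum1_size natr_sum; apply: ler_sum => J _; exact: ind_le1.
apply: (@le_trans _ _ ((M * \sum_(J <- s) ind J x) ^+ 2)).
  by rewrite ler_sqr ?nnegrE // mulr_ge0.
by rewrite exprMn -mulrA ler_wpM2l ?sqr_ge0 // expr2 ler_wpM2r.
Qed.

Lemma cubewise_bounded_mint f k : cubewise_bounded f -> loc omega k ->
  mint (fun x => f x * k x).
Proof.
move=> [mf [M [s [M0 fM]]]] [mk lk].
have mS : mint (fun x => \sum_(J <- s) `|k x * ind J x|).
  by apply: mint_sum => J; apply: mint_norm; exact: lk.
apply: (le_mint _ (mintZ M mS)); first exact: measurable_funM.
move=> x; rewrite normrM mulrC.
rewrite (eq_bigr (fun J => `|k x| * ind J x)); last first.
  by move=> J _; rewrite normrM (ger0_norm (ind_ge0 _ _ _)).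
by rewrite -mulr_sumr mulrCA ler_wpM2l.
Qed.

Lemma cubewise_bounded_loc f : cubewise_bounded f -> loc omega f.
Proof.
move=> bf; split; first by case: bf.
move=> Q; apply: cubewise_bounded_mint => //; split; first exact: measurable_ind.
move=> J; apply: mint_mul_ind; exact: mint_ind.
Qed.

Lemma DeltaNE n Q f : DeltaN omega n Q f = fun x =>
  \sum_(J <- bleaves (dtree omega n Q)) (avg omega f J - avg omega f Q) * ind J x.
Proof.
apply/funext => x; rewrite /DeltaN /Eavg.
have -> : descendants R omega n Q = [set` bleaves (dtree omega n Q)].
  apply/seteqP; split => J /=; first by move=> /descendantsP H; rewrite mem_dtree H.
  by rewrite mem_dtree => /eqP H; apply/descendantsP.
rewrite -fsbig_seq ?uniq_dtree // (indic_cube_dtree omega n Q) mulr_sumr -sumrN -big_split /=.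
by apply: eq_bigr => J _; ring.
Qed.

Lemma cubewise_bounded_DeltaN n Q f : cubewise_bounded (DeltaN omega n Q f).
Proof. by rewrite DeltaNE; apply: cubewise_bounded_sum => J; exact: cubewise_bounded_ind. Qed.

Lemma avg_step n Q (c : cidx dim -> R) K : K \in bleaves (dtree omega n Q) ->
  avg omega (fun x => \sum_(J <- bleaves (dtree omega n Q)) c J * ind J x) K = c K.
Proof.
move=> Kin; rewrite avgE; last first.
  by case: (@cubewise_bounded_sum _ (bleaves (dtree omega n Q)) (fun J x => c J * ind J x)
     (fun J => cubewise_bounded_ind (c J) J)).
have -> : (fun x => (\sum_(J <- bleaves (dtree omega n Q)) c J * ind J x) * ind K x) =
    (fun x => c K * ind K x).
  apply/funext => x; rewrite mulr_suml (bigD1_seq K) ?uniq_dtree //= -mulrA indM.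
  rewrite big_seq_cond big1 ?addr0 // => J /andP[Jin JK].
  rewrite -mulrA (ind_disjoint (n := 0)) ?mulr0 //=; last by rewrite eq_sym.
  move: Jin Kin; rewrite !mem_dtree => /eqP E1 /eqP E2.
  by rewrite addr0; move: (congr1 fst E1) (congr1 fst E2); rewrite !iter_parent1; lia.
rewrite tintZ ?tint_ind; last exact: mint_ind.
by rewrite mulrC mulfK // gt_eqF // vol_gt0.
Qed.

Lemma tint_DeltaN_mul n Q f k : loc omega k -> tint (fun x => DeltaN omega n Q f x * k x) =
  \sum_(J <- bleaves (dtree omega n Q)) (avg omega f J - avg omega f Q) * (vol R J * avg omega k J).
Proof.
move=> [mk lk]; rewrite DeltaNE.
under eq_fun do rewrite mulr_suml.
rewrite (_ : (fun x => _) = fun x => \sum_(J <- bleaves (dtree omega n Q))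
   (avg omega f J - avg omega f Q) * (k x * ind J x)); last first.
  by apply/funext => x; apply: eq_bigr => J _; rewrite -mulrA [k x * _]mulrC.
rewrite tint_sum => [|J]; last exact: mintZ.
by apply: eq_bigr => J _; rewrite tintZ // tint_avg.
Qed.

Lemma sum_vol_diff n Q f : loc omega f ->
  \sum_(J <- bleaves (dtree omega n Q)) vol R J * (avg omega f J - avg omega f Q) = 0.
Proof.
by move=> lf; rewrite -vol_bmean bmeanD bmean_cst -avg_dtree // subrr mulr0.
Qed.

(** [DeltaN] acts as an orthogonal projection: the difference of [f] is constant on the descendants
    and has mean zero on [Q], so subtracting from [g] its average over [Q] changes nothing. *)
Lemma tint_DeltaN_self n Q f g : loc omega f -> loc omega g ->
  tint (fun x => DeltaN omega n Q f x * g x) =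
  tint (fun x => DeltaN omega n Q f x * DeltaN omega n Q g x).
Proof.
move=> lf lg; rewrite !tint_DeltaN_mul //; last first.
  exact/cubewise_bounded_loc/cubewise_bounded_DeltaN.
rewrite DeltaNE; have Z := sum_vol_diff n Q lf.
rewrite -[LHS]subr0 -[X in _ - X](mulr0 (avg omega g Q)) -[in X in _ - X]Z mulr_sumr -sumrB.
by apply: eq_big_seq => J Jin; rewrite (avg_step _ Jin); ring.
Qed.

Lemma norm1_DeltaN n Q f : tint (fun x => `|DeltaN omega n Q f x|) <= vol R Q * osc omega n f Q.
Proof.
rewrite /osc vol_bmean.
have mS : mint (fun x => \sum_(J <- bleaves (dtree omega n Q))
    `|avg omega f J - avg omega f Q| * ind J x).
  by apply: mint_sum => J; apply: mintZ; exact: mint_ind.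
apply: (@le_trans _ _ _ _ _ (le_tint _ mS _)).
- apply: mint_norm; have := cubewise_bounded_mint (cubewise_bounded_DeltaN n Q f) (loc1 omega).
  by under eq_fun do rewrite mulr1.
- move=> x; rewrite DeltaNE (le_trans (ler_norm_sum _ _ _)) //.
  by apply: ler_sum => J _; rewrite normrM (ger0_norm (ind_ge0 _ _ _)).
rewrite tint_sum => [|J]; last by apply: mintZ; exact: mint_ind.
apply: ler_sum => J _; rewrite tintZ ?tint_ind; last exact: mint_ind.
by rewrite mulrC.
Qed.

(** A function of the weighted space may fail to be square integrable without the weight. The step
    function of its averages over the descendants is square integrable and has the same Haar
    difference. *)
Lemma inDeltaL2_DeltaN n Q f : loc omega f -> inDeltaL2 omega n Q (DeltaN omega n Q f).
Proof.
move=> lf; pose h x := \sum_(J <- bleaves (dtree omega n Q)) avg omega f J * ind J x.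
have bh : cubewise_bounded h.
  by apply: cubewise_bounded_sum => J; exact: cubewise_bounded_ind.
have lh := cubewise_bounded_loc bh; case: (bh) => mh _.
exists h; split.
  split=> //; apply/intRfin.
  - by apply: measurable_funM => //; exact: measurable_funX.
  - by move=> x; rewrite mulr1 sqr_ge0.
  by apply: cubewise_bounded_mint (cubewise_bounded_sqr bh) (loc1 omega).
have hJ J : J \in bleaves (dtree omega n Q) -> avg omega h J = avg omega f J.
  by move=> Jin; rewrite /h (avg_step _ Jin).
have hQ : avg omega h Q = avg omega f Q.
  rewrite (avg_dtree n Q lh) (avg_dtree n Q lf).
  rewrite !(bmean_perfect _ (perfect_dtree omega n Q)); congr (_ * _).
  by apply: eq_big_seq => J /hJ.
rewrite !DeltaNE hQ; apply/funext => x; apply: eq_big_seq => J /hJ -> //.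
Qed.

Lemma ae_eq_tint f g : measurable_fun setT f -> mint g -> Defs.ae_eq f g ->
  mint f /\ tint f = tint g.
Proof.
move=> mf mg [N [[mN N0] fg]]; have mg' := mint_measurable mg.
have NN : lebn dim N = 0%E.
  rewrite -N0 intRE; [|by apply/measurable_EFinP; exact: measurable_indic|].
    by rewrite integral_indic // setIT.
  by move=> x; rewrite lee_fin indicE ler0n.
have ae (F G : pt R dim -> \bar R) : (forall x, ~ N x -> F x = G x) ->
    ae_eq (lebn dim) setT F G.
  move=> FG; exists N; split => // x /= H; apply: contrapT => Nx.
  by apply: H => _; exact: FG.
have mfE : measurable_fun setT (EFin \o f) by exact/measurable_EFinP.
have mgE : measurable_fun setT (EFin \o g) by exact/measurable_EFinP.
split.
  move: mg => /integrableP[_ gfin]; apply/integrableP; split => //.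
  rewrite (_ : (\int[lebn dim]_x _ = \int[lebn dim]_x `|(EFin \o g) x|)%E) //.
  apply: ae_eq_integral => //; [exact: measurableT_comp|exact: measurableT_comp|].
  by apply: ae => x Nx /=; rewrite fg.
rewrite /tint /Rintegral; congr fine; apply: ae_eq_integral => //.
by apply: ae => x Nx /=; rewrite fg.
Qed.

Lemma kernel_bound (a : pt R dim -> pt R dim -> R) (M : R) P k :
  measurable_fun setT (fun xy : pt R dim * pt R dim => a xy.1 xy.2) ->
  (forall x y, `|a x y| <= M) -> mint P -> mint k ->
  `|fine (Defs.intS (fun x => fine (Defs.intS (fun y => a x y * P y)) * k x))| <=
  M * (tint (fun y => `|P y|) * tint (fun x => `|k x|)).
Proof.
move=> ma aM mP mk; have mP' := mint_measurable mP; have mk' := mint_measurable mk.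
have ma1 x : measurable_fun setT (a x).
  exact: (measurableT_comp ma (pair1_measurable x)).
have maP x : measurable_fun setT (fun y => a x y * P y) by exact: measurable_funM.
have iaP x : mint (fun y => a x y * P y).
  apply: (le_mint (maP x) (mintZ M (mint_norm mP))) => y.
  by rewrite normrM ler_wpM2r.
pose phi x := fine (Defs.intS (fun y => a x y * P y)).
have phiE x : phi x = tint (fun y => a x y * P y) by rewrite /phi intS_tint.
have phiM x : `|phi x| <= M * tint (fun y => `|P y|).
  rewrite phiE -tintZ; last exact: mint_norm.
  apply: le_trans (ler_norm_tint (iaP x)) _; apply: le_tint.
  - exact: mint_norm.
  - by apply: mintZ; exact: mint_norm.
  - by move=> y; rewrite normrM ler_wpM2r.
have mphi : measurable_fun setT phi.
  rewrite /phi; apply: (measurableT_comp (fine_measurable measurableT)).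
  have maP2 : measurable_fun setT (fun xy : pt R dim * pt R dim => a xy.1 xy.2 * P xy.2).
    by apply: measurable_funM => //; exact: measurableT_comp.
  (* The values [s = 1] and [s = -1] select the positive and negative parts, to which Tonelli's
     measurability statement applies. *)
  have mpos (s : R) : measurable_fun setT (fun x => intR (fun y => (Num.max (s * (a x y * P y)) 0)%:E)).
    have msP : measurable_fun setT (fun xy : pt R dim * pt R dim =>
        (Num.max (s * (a xy.1 xy.2 * P xy.2)) 0)%:E).
      by apply/measurable_EFinP; apply: measurable_maxr => //; exact: measurable_funM.
    have := measurable_fun_fubini_tonelli_F (m2 := lebn dim) _ msP.
    rewrite (_ : fubini_F _ _ = fun x => intR (fun y => (Num.max (s * (a x y * P y)) 0)%:E)).
      by apply=> xy; rewrite lee_fin le_max lexx orbT.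
    apply/funext => x; rewrite /fubini_F intRE //.
      by apply/measurable_EFinP; apply: measurable_maxr => //; exact: measurable_funM.
    by move=> y; rewrite lee_fin le_max lexx orbT.
  rewrite /Defs.intS; apply: emeasurable_funB.
    by have := mpos 1; under eq_fun do under eq_fun do rewrite mul1r.
  by have := mpos (-1); under eq_fun do under eq_fun do rewrite mulN1r.
have mpk : mint (fun x => phi x * k x).
  apply: (le_mint _ (mintZ (M * tint (fun y => `|P y|)) (mint_norm mk))).
    exact: measurable_funM.
  by move=> x; rewrite normrM ler_wpM2r.
rewrite intS_tint; last exact: measurable_funM.
apply: le_trans (ler_norm_tint mpk) _.
rewrite mulrA -tintZ; last exact: mint_norm.
apply: le_tint; [exact: mint_norm|by apply: mintZ; exact: mint_norm|].
by move=> x; rewrite normrM ler_wpM2r // phiM.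
Qed.

End haar_differences.

Section duality.
Context {R : realType} {dim : nat} (omega : int -> 'I_dim -> bool).
Implicit Types (f g h k w : pt R dim -> R) (Q J : cidx dim) (n : nat).

Lemma null_setE (N : set (pt R dim)) : measurable N -> Defs.null_set N <-> lebn dim N = 0%E.
Proof.
move=> mN; rewrite /Defs.null_set intRE.
- by rewrite integral_indic // setIT; split=> [[]|].
- by apply/measurable_EFinP; exact: measurable_indic.
- by move=> x; rewrite lee_fin indicE ler0n.
Qed.

Lemma ae_eq_sum (I : eqType) (s : seq I) (F G : I -> pt R dim -> R) :
  (forall i, i \in s -> measurable_fun setT (F i) /\ Defs.ae_eq (F i) (G i)) ->
  measurable_fun setT (fun x => \sum_(i <- s) F i x) /\
  Defs.ae_eq (fun x => \sum_(i <- s) F i x) (fun x => \sum_(i <- s) G i x).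
Proof.
elim: s => [|i s IH] H.
  split; first by under eq_fun do rewrite big_nil; exact: measurable_cst.
  exists set0; split; last by move=> x _; rewrite !big_nil.
  by apply/(null_setE measurable0); rewrite measure0.
have [|mS [N [NN NE]]] := IH; first by move=> j js; apply: H; rewrite inE js orbT.
have [mi [M [MM ME]]] := H i (mem_head _ _).
split; first by under eq_fun do rewrite big_cons; exact: measurable_funD.
exists (M `|` N); split; last first.
  by move=> x /not_orP[Mx Nx]; rewrite !big_cons ME // NE.
have mM := MM.1; have mN := NN.1.
have := (null_setE mM).1 MM; have := (null_setE mN).1 NN => N0 M0.
apply/(null_setE (measurableU _ _ mM mN)).
apply/eqP; rewrite eq_le measure_ge0 andbT.
by rewrite (le_trans (measureU2 _ mM mN)) // [X in (X + _)%E]M0 [X in (_ + X)%E]N0 adde0.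
Qed.

Lemma inL2wZ w (c : R) f : weight w -> inL2w w f -> inL2w w (fun x => c * f x).
Proof.
move=> ww Lf; have mF := L2_mint ww Lf; case: Lf ww => mf _ [mw w0].
have mcf : measurable_fun setT (fun x => c * f x) by exact: measurable_funM.
split=> //; apply/intRfin.
- by apply: measurable_funM => //; exact: measurable_funX.
- by move=> x; rewrite mulr_ge0 ?sqr_ge0 // ltW.
by under eq_fun do rewrite exprMn -mulrA; exact: mintZ.
Qed.

Lemma oscZ n (c : R) f Q : loc omega f -> osc omega n (fun x => c * f x) Q = `|c| * osc omega n f Q.
Proof.
move=> lf; rewrite /osc -bmeanZ; apply: eq_bmean => J.
by rewrite !avgZ // -mulrBr normrM.
Qed.

Lemma L2norm_tint w f : weight w -> inL2w w f ->
  L2norm w f = Num.sqrt (tint (fun x => f x ^+ 2 * w x)).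
Proof.
move=> ww Lf; rewrite /L2norm /L2int intR_tint //; first exact: L2_mint.
by move=> x; rewrite mulr_ge0 ?sqr_ge0 // ltW //; case: ww.
Qed.

End duality.

Theorem theorem4p1 (R : realType) (C : R) (d : nat) (omega : int -> 'I_d -> bool)
    (n : nat) (s : seq (cidx d))
    (Sh : cidx d -> (pt R d -> R) -> (pt R d -> R)) (w : pt R d -> R) :
  wittwer_const C ->
  (0 < d)%N -> (1 <= n)%N ->
  haar_shift omega n s Sh ->
  weight w -> (A2 omega w < +oo)%E ->
  forall f : pt R d -> R, inL2w w f ->
    inL2w w (haar_apply omega n s Sh f) /\
    L2norm w (haar_apply omega n s Sh f)
      <= 324 * n%:R * 2 ^+ (2 * d - 2) * C * fine (A2 omega w) * L2norm w f.
Proof.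
move=> wC d0 n0 [us HS] ww Aw f Lf.
have [lw li] := A2_loc ww Aw; have [mw w0] := ww.
have wi := weight_winv ww; have lf := L2_loc ww li Lf.
have lwK : loc omega (winv (winv w)) by rewrite winvK.
pose one : pt R d -> R := fun=> 1.
have w1 : weight one by split=> [|x]; [exact: measurable_cst|rewrite /one ltr01].
have iw1 : loc omega (winv one).
  by rewrite (_ : winv one = one); [exact: loc1|apply/funext => x; rewrite /winv invr1].
pose P Q := DeltaN omega n Q f.
have PD Q : inDeltaL2 omega n Q (P Q) := inDeltaL2_DeltaN n Q lf.
(* [Sh Q] returns a Haar difference only up to a null set; [u Q] is a function with that difference,
   arbitrary off the list. *)
have /choice[u uP] : forall Q, exists u : pt R d -> R, Q \in s ->
    [/\ measurable_fun setT (Sh Q (P Q)), loc omega u &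
        Defs.ae_eq (Sh Q (P Q)) (DeltaN omega n Q u)].
  move=> Q; have [Qs|] := boolP (Q \in s); last by exists (fun=> 0).
  have [a [_ [_ [_ [Hm _]]]]] := HS Q Qs.
  have [mSh [_ [[u [Lu ->]] ae]]] := Hm _ (PD Q).
  by exists u => _; split => //; exact: L2_loc w1 iw1 Lu.
set h := haar_apply omega n s Sh f.
pose h0 x := \sum_(Q <- s) DeltaN omega n Q (u Q) x.
have [mh hh0] : measurable_fun setT h /\ Defs.ae_eq h h0.
  by apply: ae_eq_sum => Q Qs; have [? _ ?] := uP Q Qs.
have bh0 : cubewise_bounded omega h0.
  by apply: cubewise_bounded_sum => Q; exact: cubewise_bounded_DeltaN.
have aeM (p q k : pt R d -> R) : Defs.ae_eq p q -> Defs.ae_eq (fun x => p x * k x) (fun x => q x * k x).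
  by move=> [N [NN pq]]; exists N; split=> // x /pq ->.
have mh2 : measurable_fun setT (fun x => h x ^+ 2 * w x).
  by apply: measurable_funM => //; exact: measurable_funX.
have aeh : Defs.ae_eq (fun x => h x ^+ 2 * w x) (fun x => h0 x ^+ 2 * w x).
  by apply: aeM; case: hh0 => N [NN hN]; exists N; split => // x /hN ->.
(* A priori finiteness: [h] agrees almost everywhere with a bounded function living on finitely many
   cubes, where [w] is integrable. Hence [H2] below is the true value of the integral. *)
have [ih2 _] := ae_eq_tint mh2 (cubewise_bounded_mint (cubewise_bounded_sqr bh0) lw) aeh.
have h2w0 x : 0 <= h x ^+ 2 * w x by rewrite mulr_ge0 ?sqr_ge0 // ltW.
have Lh : inL2w w h by split=> //; apply/intRfin.
split=> //; rewrite !L2norm_tint //.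
set H2 := tint (fun x => h x ^+ 2 * w x); set F2 := tint _.
(* The extremal dual function: [h g] and [g^2 / w] both equal [h^2 w], so the pairing and the
   squared dual norm are the same number [H2]. *)
pose g x := h x * w x.
have gE x : g x ^+ 2 * winv w x = h x ^+ 2 * w x.
  by rewrite /g /winv; field; rewrite gt_eqF.
have mg : measurable_fun setT g by exact: measurable_funM.
have Lg : inL2w (winv w) g.
  by split=> //; rewrite /L2int; under eq_fun do rewrite gE; case: Lh.
have lg := L2_loc wi lwK Lg.
have H2E : H2 = \sum_(Q <- s) tint (fun x => DeltaN omega n Q (u Q) x * g x).
  rewrite -tint_sum; last first.
    by move=> Q; exact: cubewise_bounded_mint (cubewise_bounded_DeltaN _ _ _ _) lg.
  have [_ E] := ae_eq_tint (measurable_funM mh mg) (cubewise_bounded_mint bh0 lg) (aeM _ _ g hh0).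
  transitivity (tint (fun x => h0 x * g x)).
    by rewrite -E; congr tint; apply/funext => x /=; rewrite /g mulrA expr2.
  by congr tint; apply/funext => x; rewrite /h0 mulr_suml.
(* Self-adjointness replaces [g] by its Haar difference; the kernel bound then gives [1/|Q|] times
   the two [L^1] norms, each at most [|Q|] times an oscillation. *)
have HQ Q : Q \in s -> tint (fun x => DeltaN omega n Q (u Q) x * g x) <=
    vol R Q * (osc omega n f Q * osc omega n g Q).
  move=> Qs; have [mSh lu ae] := uP Q Qs.
  have bg := cubewise_bounded_DeltaN omega n Q g.
  have bP := cubewise_bounded_DeltaN omega n Q f.
  have lDg := cubewise_bounded_loc bg; have mDg := bg.1.
  rewrite tint_DeltaN_self //.
  have [_ <-] := ae_eq_tint (measurable_funM mSh mDg : measurable_fun setT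
      (fun x => Sh Q (P Q) x * DeltaN omega n Q g x))
    (cubewise_bounded_mint (cubewise_bounded_DeltaN omega n Q (u Q)) lDg) (aeM _ _ _ ae).
  have [a [ma [_ [aM [_ Ha]]]]] := HS Q Qs.
  rewrite -intS_tint; last exact: measurable_funM.
  rewrite (Ha _ _ (PD Q) (inDeltaL2_DeltaN n Q lg)).
  have mint_of (p : pt R d -> R) : cubewise_bounded omega p -> mint p.
    by move=> bp; have := cubewise_bounded_mint bp (loc1 omega); under eq_fun do rewrite mulr1.
  apply: le_trans (ler_norm _) _.
  have KB := kernel_bound ma aM (mint_of _ bP) (mint_of _ bg).
  apply: (le_trans KB).
  have v0 := vol_gt0 (R := R) Q.
  rewrite ler_pdivrMl //; have -> : vol R Q * (vol R Q * (osc omega n f Q * osc omega n g Q)) =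
    (vol R Q * osc omega n f Q) * (vol R Q * osc omega n g Q) by ring.
  by apply: ler_pM; [exact: tint_ge0|exact: tint_ge0|exact: norm1_DeltaN|exact: norm1_DeltaN].
have C0 := wittwer_const_ge0 wC.
have A0 : 0 <= fine (A2 omega w).
  apply: le_trans (A2_avg (0, [ffun=> 0]) ww Aw).
  by apply: le_trans (A2_ge1 _ w0 lw li).
set k := 320 * n%:R * C * (2 ^+ (2 * d - 2) * fine (A2 omega w)).
have k0 : 0 <= k by rewrite /k !mulr_ge0 // ?ler0n ?exprn_ge0.
have H20 : 0 <= H2 by exact: tint_ge0.
have F20 : 0 <= F2 by apply: tint_ge0 => x; rewrite mulr_ge0 ?sqr_ge0 // ltW.
(* Replacing [f] by [l f] and [g] by [g / l] preserves every product of oscillations but rebalances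
   the two energies. *)
have key (l : R) : 0 < l -> H2 <= k / 2 * (l ^+ 2 * F2 + l ^- 2 * H2).
  move=> l0; have l'0 : 0 < l^-1 by rewrite invr_gt0.
  have := carleson_embedding wC d0 n0 ww Aw us (inL2wZ l ww Lf) (inL2wZ l^-1 wi Lg).
  have -> : tint (fun x => (l * f x) ^+ 2 * w x) = l ^+ 2 * F2.
    by rewrite -tintZ; [congr tint; apply/funext => x; rewrite exprMn mulrA|exact: L2_mint].
  have -> : tint (fun x => (l^-1 * g x) ^+ 2 * winv w x) = l ^- 2 * H2.
    rewrite -tintZ //; congr tint; apply/funext => x.
    by rewrite exprMn -mulrA gE exprVn.
  have -> : \sum_(Q <- s) vol R Q * (osc omega n (fun x => l * f x) Q *
      osc omega n (fun x => l^-1 * g x) Q) = \sum_(Q <- s) vol R Q * (osc omega n f Q * osc omega n g Q).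
    apply: eq_bigr => Q _; rewrite !oscZ // !gtr0_norm //.
    by congr (_ * _); field; rewrite gt_eqF.
  have : H2 <= \sum_(Q <- s) vol R Q * (osc omega n f Q * osc omega n g Q).
    by rewrite H2E big_seq [leRHS]big_seq; apply: ler_sum.
  by move=> h1 h2; apply: (le_trans h1); apply: (le_trans h2); rewrite /k; lra.
(* With [l^2 = k] the right side contains [H2 / 2], which is absorbed on the left. If [k = 0], any
   [l] gives [H2 <= 0]. *)
have H2k : H2 <= k ^+ 2 * F2.
  move: k0; rewrite le_eqVlt => /predU1P[k0|k0].
    by have := key 1 ltr01; rewrite -k0 mul0r mul0r expr0n mul0r.
  have sk : 0 < Num.sqrt k by rewrite sqrtr_gt0.
  have := key _ sk; rewrite sqr_sqrtr ?(ltW k0) // => h1.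
  have E : k / 2 * (k * F2 + k^-1 * H2) = (k ^+ 2 * F2 + H2) / 2 by field; rewrite gt_eqF.
  by rewrite E in h1; lra.
apply: (@le_trans _ _ (k * Num.sqrt F2)).
  rewrite -[X in X * _](ger0_norm k0) -sqrtr_sqr -sqrtrM ?sqr_ge0 //.
  by rewrite ler_wsqrtr.
(* [k] carries the constant 320, so 324 leaves some slack. *)
rewrite ler_wpM2r ?sqrtr_ge0 //.
have : 0 <= n%:R * 2 ^+ (2 * d - 2) * C * fine (A2 omega w).
  by rewrite !mulr_ge0 ?ler0n ?exprn_ge0.
by rewrite /k; lra.
Qed.
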